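(* Let $\Sigma$ be an ovoid with support function $p$ and let $w$ be a positive constant. Then $\Sigma$ is a surface of constant width $w$ if and only if $$\rho_{\mathrm{mean}}(P)+\rho_{\mathrm{mean}}(Q)=w$$ for every pair of opposite points $P,Q\in\Sigma$.
   Context: An ovoid is a bounded simply connected convex smooth surface $\Sigma\subset\mathbb{R}^3$ that has a tangent plane at each point and lies entirely on one side of each tangent plane; the origin is chosen inside $\Sigma$. Its support function $p(t,u)$ is the distance from the origin to the tangent plane with unit outward normal $\mathbf{n}=(\cos t\sin u,\ \sin t\sin u,\ \cos u)$, $0\le t<2\pi$, $0\le u\le\pi$; $p$ is assumed to be sufficiently differentiable (derivatives through second order are used) and to have a convergent Fourier series in $(t,u)$. The point with parameters $(t,u)$ is the point of $\Sigma$ with outward normal $\mathbf{n}(t,u)$. The width in direction $\mathbf{n}$ is $w(t,u)=p(t,u)+p(t+\pi,\pi-u)$, and $\Sigma$ is a surface of constant width $w$ if $w(t,u)=w$ for all $(t,u)$. Points $P$ and $Q$ of $\Sigma$ are opposite if $P$ has parameters $(t,u)$ and $Q$ has parameters $(t+\pi,\pi-u)$, i.e. the outward normal at $Q$ is the negative of that at $P$. The principal radii of curvature at a point are the reciprocals $\rho_k=1/\kappa_k$, $k=0,1$, of the principal curvatures; equivalently, they are the eigenvalues of $\nabla^2p+p\,I$ on the tangent plane at $\mathbf{n}$ of the unit sphere, where $p$ is regarded as a function on the sphere and $\nabla^2$ is the spherical Hessian (this also covers a vanishing radius). The mean radius of curvature is $\rho_{\mathrm{mean}}=\frac12(\rho_0+\rho_1)$.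 *)

(* Defs.v *)
From HB Require Import structures.
From mathcomp Require Import all_boot all_order all_algebra.
From mathcomp Require Import all_classical all_reals all_analysis.
Set Implicit Arguments.
Unset Strict Implicit.
Unset Printing Implicit Defensive.
Import Order.TTheory GRing.Theory Num.Theory.
Import numFieldNormedType.Exports.
Local Open Scope classical_set_scope.
Local Open Scope ring_scope.

(* The library norm on 'rV[R]_3 is the sup norm, hence the separate Euclidean
   norm below; the two define the same topology and the same derivatives. *)
Definition dot (R : realType) (x y : 'rV[R]_3) : R :=
  \sum_(i < 3) x 0 i * y 0 i.

Definition enorm (R : realType) (x : 'rV[R]_3) : R := Num.sqrt (dot x x).

Definition unit_vector (R : realType) (x : 'rV[R]_3) : Prop := enorm x = 1.

Definition plane (R : realType) (x nu : 'rV[R]_3) : set 'rV[R]_3 :=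
  [set y | dot (y - x) nu = 0].

(* The secant directions (y - x) / |y - x|, y in Sigma, become orthogonal to nu
   as y tends to x. *)
Definition tangent_plane (R : realType) (Sigma : set 'rV[R]_3)
    (x nu : 'rV[R]_3) : Prop :=
  [/\ Sigma x, unit_vector nu &
      dot (y - x) nu / enorm (y - x) @[y --> within Sigma x^'] --> (0 : R)].

Definition outward_normal (R : realType) (Sigma : set 'rV[R]_3)
    (x nu : 'rV[R]_3) : Prop :=
  tangent_plane Sigma x nu /\ forall y, Sigma y -> dot (y - x) nu <= 0.

(* A bounded convex surface is the boundary of a compact convex set K with
   interior points.  Radial projection from the origin, an interior point of K,
   is then a homeomorphism of Sigma onto the unit sphere, so that Sigma is
   automatically a simply connected surface. *)
Definition ovoid (R : realType) (Sigma : set 'rV[R]_3) : Prop :=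
  exists K : set 'rV[R]_3,
    [/\ convex_set K, compact K, K° 0 & Sigma = closure K `\` K°] /\
    (forall x, Sigma x -> exists nu, tangent_plane Sigma x nu) /\
    (forall x nu, tangent_plane Sigma x nu ->
       (forall y, Sigma y -> dot (y - x) nu <= 0) \/
       (forall y, Sigma y -> 0 <= dot (y - x) nu)).

Definition sphere_normal (R : realType) (t u : R) : 'rV[R]_3 :=
  \row_(i < 3) [:: cos t * sin u; sin t * sin u; cos u]`_i.

(* The support function is taken as a function p on the unit sphere; its values
   elsewhere are irrelevant.  The function p(t,u) is [param p]. *)
Definition support_function (R : realType) (Sigma : set 'rV[R]_3)
    (p : 'rV[R]_3 -> R) : Prop :=
  forall nu, unit_vector nu ->
    exists2 x, outward_normal Sigma x nu & p nu = inf (@enorm R @` plane x nu).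

Definition param (R : realType) (p : 'rV[R]_3 -> R) (t u : R) : R :=
  p (sphere_normal t u).

Definition param_domain (R : realType) (t u : R) : Prop :=
  0 <= t < 2 * pi /\ 0 <= u <= pi.

Definition width (R : realType) (p : 'rV[R]_3 -> R) (t u : R) : R :=
  param p t u + param p (t + pi) (pi - u).

Definition constant_width (R : realType) (p : 'rV[R]_3 -> R) (w : R) : Prop :=
  forall t u, param_domain t u -> width p t u = w.

Definition opposite (R : realType) (Sigma : set 'rV[R]_3)
    (P Q : 'rV[R]_3) : Prop :=
  exists t u, [/\ param_domain t u,
    outward_normal Sigma P (sphere_normal t u) &
    outward_normal Sigma Q (sphere_normal (t + pi) (pi - u))].

(* A function on the sphere is differentiated through its extension to
   R^3 \ {0} that is constant along the rays issued from the origin. *)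
Definition radial_extension (R : realType) (p : 'rV[R]_3 -> R)
    (x : 'rV[R]_3) : R :=
  p ((enorm x)^-1 *: x).

Definition C1_off_origin (R : realType) (f : 'rV[R]_3 -> R) : Prop :=
  forall x : 'rV[R]_3, x != 0 ->
    differentiable f x /\
    forall v : 'rV[R]_3, {for x, continuous (fun y => 'D_v f y)}.

Definition C2_on_sphere (R : realType) (p : 'rV[R]_3 -> R) : Prop :=
  C1_off_origin (radial_extension p) /\
  forall v : 'rV[R]_3, C1_off_origin (fun y => 'D_v (radial_extension p) y).

(* At a unit vector this gradient is tangent to the sphere, and is the gradient
   on the sphere, since the extension has no radial derivative. *)
Definition sphere_grad (R : realType) (p : 'rV[R]_3 -> R)
    (x : 'rV[R]_3) : 'rV[R]_3 :=
  \row_(i < 3) 'D_(delta_mx 0 i) (radial_extension p) x.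

(* The Hessian as an endomorphism of the tangent plane at nu,
   v |-> nabla_v (grad p): the Levi-Civita connection of the sphere is the
   tangential part of the derivative in R^3. *)
Definition sphere_hessian (R : realType) (p : 'rV[R]_3 -> R)
    (nu v : 'rV[R]_3) : 'rV[R]_3 :=
  let d := 'D_v (sphere_grad p) nu in d - dot d nu *: nu.

(* Eigenvalues, with multiplicity, of the symmetric operator nabla^2 p + p I on
   the tangent plane at nu: e0, e1 is an orthonormal basis of eigenvectors. *)
Definition radii_at_normal (R : realType) (p : 'rV[R]_3 -> R)
    (nu : 'rV[R]_3) (rho0 rho1 : R) : Prop :=
  exists e0 e1 : 'rV[R]_3,
    [/\ dot e0 nu = 0, dot e1 nu = 0, unit_vector e0, unit_vector e1 &
        dot e0 e1 = 0] /\
    sphere_hessian p nu e0 + p nu *: e0 = rho0 *: e0 /\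
    sphere_hessian p nu e1 + p nu *: e1 = rho1 *: e1.

Definition principal_radii (R : realType) (Sigma : set 'rV[R]_3)
    (p : 'rV[R]_3 -> R) (P : 'rV[R]_3) (rho0 rho1 : R) : Prop :=
  exists2 nu, outward_normal Sigma P nu & radii_at_normal p nu rho0 rho1.

Definition mean_radius (R : realType) (Sigma : set 'rV[R]_3)
    (p : 'rV[R]_3 -> R) (P : 'rV[R]_3) (rho : R) : Prop :=
  exists rho0 rho1, principal_radii Sigma p P rho0 rho1 /\
    rho = (rho0 + rho1) / 2.

(* Real form of the Fourier partial sum
   sum_(|m| <= M, |n| <= N) c_(m,n) exp(i (m t + n u)) of a function that is
   2 pi-periodic in t and in u; k stands for m + M and l for n + N. *)
Definition fourier_coef (R : realType) (trig : R -> R) (f : R -> R -> R)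
    (m n : int) : R :=
  (4 * pi ^+ 2)^-1 *
  Rintegral lebesgue_measure `[0, 2 * pi]%classic (fun t =>
    Rintegral lebesgue_measure `[0, 2 * pi]%classic (fun u =>
      f t u * trig (m%:~R * t + n%:~R * u))).

Definition fourier_partial (R : realType) (f : R -> R -> R) (M N : nat)
    (t u : R) : R :=
  \sum_(k < (2 * M).+1) \sum_(l < (2 * N).+1)
    let m := (k%:Z - M%:Z)%R in let n := (l%:Z - N%:Z)%R in
    fourier_coef (@cos R) f m n * cos (m%:~R * t + n%:~R * u) +
    fourier_coef (@sin R) f m n * sin (m%:~R * t + n%:~R * u).

Definition fourier_convergent (R : realType) (f : R -> R -> R) : Prop :=
  forall t u : R,
    fourier_partial f MN.1 MN.2 t u @[MN --> (\oo, \oo)] --> f t u.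

(* Main.v *)
Require Import Defs.
From mathcomp Require Import all_boot all_order all_algebra.
From mathcomp Require Import all_classical all_reals all_analysis.
From mathcomp Require Import ring lra.
Import Order.TTheory GRing.Theory Num.Theory.
Import numFieldNormedType.Exports.
Local Open Scope classical_set_scope.
Local Open Scope ring_scope.
Set Implicit Arguments.
Unset Strict Implicit.
Unset Printing Implicit Defensive.

(** Extend the support function [p] from the sphere to a function [F] on
    [R^3 \ {0}] that is constant along rays.  The radial direction is isotropic
    for the Hessian of [F] at a unit vector [n], so that taking traces gives
    [rho0 + rho1 = Lap F n + 2 p n] at the point with outward normal [n]
    ([radii_sum]).  Put [q n = p n + p (- n) - w], with the extension
    [G x = F x + F (- x) - w].  The sum of the two mean radii at opposite points
    minus [w] is then half of [Lap G n + 2 q n], and constant width [w] means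
    that [q = 0].  One implication is immediate from this, once it is known that
    a point of an ovoid has a single outward normal ([outward_normal_unique]),
    so that its radii are those computed at that normal.

    Conversely, let [Lap G n + 2 q n = 0] on the sphere.  The function
    [H x = |x| G x] is homogeneous of degree 1, even, and
    [Lap H = |x| Lap G + 2 G / |x|] vanishes off the origin.  It has to be
    shown that [H = 0]: on the sphere, the eigenvalue 2 of the Laplacian has only
    odd eigenfunctions.  A direct argument replaces spherical harmonics.  For
    [a <> 0] the second difference [H (x + a) + H (x - a) - 2 H x] is harmonic
    off the three poles [0], [a], [- a], bounded near them, and at most
    [C / |x|] at infinity.  Comparison with small multiples of the sum of the
    barriers [|x - pole|^(-1/2)], which are strictly superharmonic, infinite at
    the poles and larger than [C / |x|] at infinity, shows that it is
    nonpositive ([second_diff_nonpos]); applied to [- H] as well, it is 0.  At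
    [x = a / 2] homogeneity and evenness reduce it to [H a]
    ([even_harmonic_eq0]).

    To use the hypothesis on the radii in this direction, radii have to exist at
    every normal ([radii_exist]); this rests on the symmetry of the second
    derivatives ([derive2C]).  Uniqueness of the normal compares two outward
    normals at [x] along boundary points near [x] in a direction orthogonal to
    [x]; there the boundary is Lipschitz by convexity ([boundary_curve]). *)

(** * Iterated directional derivatives *)

Section DirectionalDerivatives.
Context {R : realType} {V : normedModType R}.
Implicit Types (f g : V -> R) (x v b : V) (A : set V).

(** The derivative of [f] in the direction [v] depends only on the restriction
    of [f] to a line; this transfers one-variable calculus to [V]. *)
Lemma derive_line f x v (t : R) :
  'D_v f (t *: v + x) = 'D_1 (fun h : R => f (h *: v + x)) t.
Proof.
rewrite /derive; set g1 := fun h => h^-1 *: _; set g2 := fun h => h^-1 *: _.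
suff -> : g1 = g2 by [].
by apply/funext => h; rewrite /g1 /g2 /= addrA -scalerDl [h *: 1]mulr1.
Qed.

Lemma derivable_line f x v (t : R) :
  derivable f (t *: v + x) v <-> derivable (fun h : R => f (h *: v + x)) t 1.
Proof.
rewrite /derivable.
suff -> : (fun h => h^-1 *: ((f \o shift (t *: v + x)) (h *: v) - f (t *: v + x)))
   = (fun h : R => h^-1 *: (((fun h : R => f (h *: v + x)) \o shift t) (h *: 1)
      - f (t *: v + x))) by [].
by apply/funext => h /=; rewrite addrA -scalerDl [h *: 1]mulr1.
Qed.

Lemma is_derive_line f x v (t d : R) :
  is_derive (t *: v + x) v f d <->
  is_derive t 1 (fun h : R => f (h *: v + x)) d.
Proof.
split=> -[df <-]; apply: DeriveDef.
- exact/derivable_line.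
- by rewrite -[LHS]derive_line.
- exact/derivable_line.
- exact: derive_line.
Qed.

Lemma is_derive_chain f x v (phi : R -> R) (d c : R) :
  is_derive x v f d -> is_derive (f x) 1 phi c -> is_derive x v (phi \o f) (c * d).
Proof.
have x0 : x = 0 *: v + x by rewrite scale0r add0r.
move=> hf hphi; rewrite x0; apply/(is_derive_line (phi \o f)).
have hf' : is_derive (0 : R) (1 : R) (fun h : R => f (h *: v + x)) d.
  by apply/(is_derive_line f); rewrite -x0.
have hphi' : is_derive ((fun h : R => f (h *: v + x)) 0) (1 : R) phi c by rewrite -x0.
exact: is_derive1_comp hphi' hf'.
Qed.

Lemma derive_affine f (c : R) b v :
  'D_v (fun y => f (c *: y + b)) = (fun x => 'D_(c *: v) f (c *: x + b)).
Proof.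
apply/funext => x; rewrite /derive.
set g1 := fun h => h^-1 *: _; set g2 := fun h => h^-1 *: _.
suff -> : g1 = g2 by [].
by apply/funext => h; rewrite /g1 /g2 /=; congr (_ *: (f _ - _));
  rewrite scalerDr !scalerA (mulrC c) addrA.
Qed.

Lemma derivable_affine f (c : R) b v x :
  derivable f (c *: x + b) (c *: v) -> derivable (fun y => f (c *: y + b)) x v.
Proof.
rewrite /derivable.
suff -> : (fun h => h^-1 *: (((fun y => f (c *: y + b)) \o shift x) (h *: v) -
     f (c *: x + b)))
   = (fun h => h^-1 *: ((f \o shift (c *: x + b)) (h *: (c *: v)) -
     f (c *: x + b))) by [].
by apply/funext => h /=; congr (_ *: (f _ - _));
  rewrite scalerDr !scalerA (mulrC c) addrA.
Qed.

(** [smooth k A f]: the iterated directional derivatives of [f], up to order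
    [k], exist and are continuous at the points of [A].  For an open set [A] this
    is the class C^k; only [A] open is used. *)
Fixpoint smooth (k : nat) A f : Prop :=
  (forall x, A x -> {for x, continuous f}) /\
  (if k is k'.+1 then
    forall v, (forall x, A x -> derivable f x v) /\ smooth k' A ('D_v f)
   else True).

Lemma smooth_continuous k A f x : smooth k A f -> A x -> {for x, continuous f}.
Proof. by case: k => [|k] /= -[cf _] /cf. Qed.

Lemma smooth_derivable k A f x v : smooth k.+1 A f -> A x -> derivable f x v.
Proof. by move=> [_ /(_ v)[h _]] /h. Qed.

Lemma smooth_derive k A f v : smooth k.+1 A f -> smooth k A ('D_v f).
Proof. by move=> [_ /(_ v)[_ h]]. Qed.

Lemma smoothS k A f : (forall x, A x -> {for x, continuous f}) ->
  (forall v x, A x -> derivable f x v) -> (forall v, smooth k A ('D_v f)) ->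
  smooth k.+1 A f.
Proof. by move=> cf df sf; split => // v; split => // x; exact: df. Qed.

Lemma smooth_le k A f : smooth k.+1 A f -> smooth k A f.
Proof.
elim: k f => [|k IH] f; first by case.
move=> sf; apply: smoothS => [x|v x|v]; first exact: smooth_continuous sf.
  exact: smooth_derivable sf.
exact/IH/smooth_derive.
Qed.

Lemma smooth_sub k A B f : B `<=` A -> smooth k A f -> smooth k B f.
Proof.
move=> BA; elim: k f => [|k IH] f sf.
  by split=> // x /BA; exact: smooth_continuous sf.
apply: smoothS => [x /BA|v x /BA|v]; first exact: smooth_continuous sf.
  exact: smooth_derivable sf.
exact/IH/smooth_derive.
Qed.

Lemma open_eq_near A f g x : open A -> A x -> (forall y, A y -> f y = g y) ->
  {near x, f =1 g}.
Proof.
move=> oA Ax fg; have : nbhs x A by exact: open_nbhs_nbhs.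
by apply: filterS => y /fg.
Qed.

Lemma open_eq_derive A f g x v : open A -> A x ->
  (forall y, A y -> f y = g y) -> 'D_v f x = 'D_v g x.
Proof. by move=> oA Ax fg; apply/near_eq_derive/(open_eq_near oA Ax). Qed.

Lemma smooth_ext k A f g : open A -> (forall x, A x -> f x = g x) ->
  smooth k A f -> smooth k A g.
Proof.
move=> oA; elim: k f g => [|k IH] f g fg sf.
  split=> // x Ax; have cf := smooth_continuous sf Ax.
  rewrite /prop_for /continuous_at -fg//; apply: cvg_trans cf.
  by apply: near_eq_cvg; exact: open_eq_near fg.
apply: smoothS => [x Ax|v x Ax|v].
- have cf := smooth_continuous sf Ax.
  rewrite /prop_for /continuous_at -fg//; apply: cvg_trans cf.
  by apply: near_eq_cvg; exact: open_eq_near fg.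
- apply: (near_eq_derivable (open_eq_near oA Ax fg)).
  exact: smooth_derivable sf Ax.
- apply: (IH ('D_v f)); last exact: smooth_derive.
  by move=> x Ax; exact: open_eq_derive fg.
Qed.

Lemma smooth_cst k A (c : R) : smooth k A (cst c).
Proof.
elim: k c => [|k IH] c; first by split => // x _; exact: cst_continuous.
apply: smoothS => [x _|v x _|v]; [exact: cst_continuous|exact: derivable_cst|].
rewrite [X in smooth _ _ X](_ : _ = cst 0); first exact: IH.
by apply/funext => x; rewrite derive_cst.
Qed.

Lemma smoothD k A f g : open A -> smooth k A f -> smooth k A g ->
  smooth k A (fun x => f x + g x).
Proof.
move=> oA; elim: k f g => [|k IH] f g sf sg.
  split=> // x Ax; apply: (@continuousD _ _ _ f g).
    exact: smooth_continuous sf Ax.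
  exact: smooth_continuous sg Ax.
apply: smoothS => [x Ax|v x Ax|v].
- apply: (@continuousD _ _ _ f g).
    exact: smooth_continuous sf Ax.
  exact: smooth_continuous sg Ax.
- apply: (@derivableD _ _ _ f g).
    exact: smooth_derivable sf Ax.
  exact: smooth_derivable sg Ax.
- apply: (smooth_ext oA _ (IH _ _ (smooth_derive v sf) (smooth_derive v sg))).
  move=> x Ax; rewrite (@deriveD _ _ _ f g)//.
    exact: smooth_derivable sf Ax.
  exact: smooth_derivable sg Ax.
Qed.

Lemma smoothM k A f g : open A -> smooth k A f -> smooth k A g ->
  smooth k A (fun x => f x * g x).
Proof.
move=> oA; elim: k f g => [|k IH] f g sf sg.
  split=> // x Ax; apply: (@continuousM _ _ f g).
    exact: smooth_continuous sf Ax.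
  exact: smooth_continuous sg Ax.
apply: smoothS => [x Ax|v x Ax|v].
- apply: (@continuousM _ _ f g).
    exact: smooth_continuous sf Ax.
  exact: smooth_continuous sg Ax.
- apply: (@derivableM _ _ f g).
    exact: smooth_derivable sf Ax.
  exact: smooth_derivable sg Ax.
- apply: (smooth_ext oA _ (smoothD oA
    (IH _ _ (smooth_le sf) (smooth_derive v sg))
    (IH _ _ (smooth_le sg) (smooth_derive v sf)))).
  move=> x Ax; rewrite (@deriveM _ _ f g)//.
    exact: smooth_derivable sf Ax.
  exact: smooth_derivable sg Ax.
Qed.

Lemma smoothZ k A (c : R) f : open A -> smooth k A f ->
  smooth k A (fun x => c * f x).
Proof. by move=> oA; exact/smoothM/smooth_cst. Qed.

Lemma affine_continuous (c : R) b : continuous (fun x : V => c *: x + b).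
Proof.
move=> x; apply: cvgD; last exact: cvg_cst.
exact: scaler_continuous.
Qed.

Lemma smooth_affine k A f (c : R) b : smooth k A f ->
  smooth k ((fun x => c *: x + b) @^-1` A) (fun x => f (c *: x + b)).
Proof.
elim: k f => [|k IH] f sf.
  split=> // x /= Ax.
  apply: (@continuous_comp _ _ _ (fun x => c *: x + b) f); first exact: affine_continuous.
  exact: smooth_continuous sf Ax.
apply: smoothS => [x /= Ax|v x /= Ax|v].
- apply: (@continuous_comp _ _ _ (fun x => c *: x + b) f); first exact: affine_continuous.
  exact: smooth_continuous sf Ax.
- by apply: derivable_affine; exact: smooth_derivable sf Ax.
- rewrite derive_affine; apply: (IH ('D_(c *: v) f)).
  exact: smooth_derive.
Qed.

End DirectionalDerivatives.

(** * Second-order directional derivatives *)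

Section SecondOrder.
Context {R : realType} {V : normedModType R}.
Implicit Types (f g : V -> R) (x v b : V) (A : set V).

Lemma derive_MVT f x v (s : R) : 0 < s ->
  (forall t, 0 <= t <= s -> derivable f (t *: v + x) v) ->
  exists2 t, 0 < t < s & f (s *: v + x) - f x = s * 'D_v f (t *: v + x).
Proof.
move=> s0 df; pose g := fun h : R => f (h *: v + x).
have dg t : 0 <= t <= s -> derivable g t 1 by move=> /df; exact: (derivable_line f x v t).1.
have [||t] := @MVT R g (fun t => 'D_v f (t *: v + x)) 0 s s0.
- move=> t; rewrite in_itv/= => /andP[t0 ts].
  by apply: (is_derive_line f x v t _).1; apply/derivableP/df; rewrite !ltW.
- by apply: derivable_within_continuous => t; rewrite in_itv/= => /dg.
rewrite in_itv/= => ts; rewrite /g scale0r add0r subr0 mulrC => E.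
by exists t.
Qed.

Lemma derive2_local_max A f x v : open A -> A x -> smooth 2 A f ->
  (\forall y \near x, f y <= f x) -> 'D_v ('D_v f) x <= 0.
Proof.
move=> oA Ax sf fx; rewrite leNgt; apply/negP => D0.
have sdf := smooth_derive v sf; have sddf := smooth_derive v sdf.
have : \forall y \near x, [/\ A y, f y <= f x & 0 < 'D_v ('D_v f) y].
  near=> y; split.
  - by near: y; exact: (open_nbhs_nbhs (conj oA Ax)).
  - by near: y.
  - by near: y; exact: cvgr_gt (smooth_continuous sddf Ax) _ D0.
move=> /nbhs_ballP[r /= r0 br].
pose d := r / (`|v| + 1).
have v1 : 0 < `|v| + 1 by rewrite ltr_wpDl.
have d0 : 0 < d by rewrite divr_gt0.
have B t : `|t| < d -> [/\ A (t *: v + x), f (t *: v + x) <= f x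
    & 0 < 'D_v ('D_v f) (t *: v + x)].
  move=> td; apply: br; rewrite -ball_normE /= opprD addrCA subrr addr0 normrN normrZ.
  rewrite (@le_lt_trans _ _ (`|t| * (`|v| + 1)))// ?ler_wpM2l// ?lerDl//.
  by rewrite -ltr_pdivlMr.
have Dx0 : 'D_v f x = 0.
  have x0 : x = 0 *: v + x by rewrite scale0r add0r.
  rewrite x0 derive_line; apply: derive_val.
  apply: (@derive1_at_max R _ (- d) d).
  - lra.
  - move=> t; rewrite in_itv/= => td; apply: (derivable_line f x v t).1.
    by apply: smooth_derivable sf _; have [] := B t; rewrite // ltr_norml.
  - by rewrite in_itv/=; lra.
  - move=> t; rewrite in_itv/= => td; rewrite -x0.
    by have [] := B t; rewrite // ltr_norml.
have d20 : 0 < d / 2 by lra.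
have [||t /andP[t0 td]] := @derive_MVT f x v (d / 2).
- by [].
- move=> t t0; apply: smooth_derivable sf _.
  by have [] := B t; rewrite // ltr_norml; lra.
have [||t' /andP[t'0 t't]] := @derive_MVT ('D_v f) x v t.
- by [].
- move=> t' t'0; apply: smooth_derivable sdf _.
  by have [] := B t'; rewrite // ltr_norml; lra.
rewrite Dx0 subr0 => -> E.
have [_ _ D'] : [/\ A (t' *: v + x), f (t' *: v + x) <= f x
    & 0 < 'D_v ('D_v f) (t' *: v + x)].
  apply: B; rewrite ger0_norm ?ltW// (lt_trans t't)// (lt_trans td)//.
  by rewrite ltr_pdivrMr// mulr2n mulrDr mulr1 ltrDl.
have [_ fle _] : [/\ A ((d / 2) *: v + x), f ((d / 2) *: v + x) <= f x
    & 0 < 'D_v ('D_v f) ((d / 2) *: v + x)].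
  by apply: B; rewrite ger0_norm ?ltW// ltr_pdivrMr// mulr2n mulrDr mulr1 ltrDl.
by move: fle; rewrite -subr_le0 E leNgt !mulr_gt0.
Unshelve. all: by end_near. Qed.

(** Two applications of the mean value theorem, to
    [y |-> f (y + s v) - f y] in the direction [u], then to ['D_u f] in the
    direction [v]. *)
Lemma second_difference A f x u v (s : R) : smooth 2 A f -> 0 < s ->
  (forall t t', 0 <= t <= s -> 0 <= t' <= s -> A (t *: u + t' *: v + x)) ->
  exists t t', [/\ 0 < t < s, 0 < t' < s &
    f (s *: u + s *: v + x) - f (s *: u + x) - f (s *: v + x) + f x =
      s * (s * 'D_v ('D_u f) (t *: u + t' *: v + x))].
Proof.
move=> sf s0 As.
pose phi y := f (y + s *: v) - f y.
have A0 t : 0 <= t <= s -> A (t *: u + x).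
  by move=> ts; have := As t 0 ts; rewrite scale0r addr0; apply; lra.
have A1 t : 0 <= t <= s -> A (t *: u + x + s *: v).
  by move=> ts; rewrite addrAC; apply: As; rewrite // lexx ltW.
have dsh y : A (y + s *: v) -> is_derive y u (fun y => f (y + s *: v))
    ('D_u f (y + s *: v)).
  move=> Ay; have E : (fun y => f (y + s *: v)) = (fun y => f (1 *: y + s *: v)).
    by apply/funext => z; rewrite scale1r.
  rewrite E; apply: DeriveDef.
    by apply: derivable_affine; rewrite !scale1r; exact: smooth_derivable sf Ay.
  by rewrite [LHS](congr1 (@^~ y) (derive_affine f 1 (s *: v) u)) !scale1r.
have dphi t : 0 <= t <= s -> is_derive (t *: u + x) u phi
    ('D_u f (t *: u + x + s *: v) - 'D_u f (t *: u + x)).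
  move=> ts; apply: (@is_deriveB _ _ _ (fun y => f (y + s *: v)) f).
    exact/dsh/A1.
  by apply: derivableP; apply: smooth_derivable sf _; exact: A0.
have [|t ts] := @derive_MVT phi x u s s0.
  by move=> t /dphi [].
have ts' : 0 <= t <= s by lra.
rewrite (@derive_val _ _ _ _ _ _ _ (dphi t ts')) => E1.
have [|t' t's] := @derive_MVT ('D_u f) (t *: u + x) v s s0.
  move=> t' t's; apply: smooth_derivable (smooth_derive u sf) _.
  by rewrite addrCA addrA; exact: As.
rewrite (addrC (s *: v)) => E2.
exists t, t'; split => //.
have -> : t *: u + t' *: v + x = t' *: v + (t *: u + x) by rewrite addrCA addrA.
rewrite -E2 -E1 /phi (addrAC (s *: u) x) (addrC x).
by rewrite opprB addrA addrAC.
Qed.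

Lemma ball_close A f g x (e : R) : open A -> A x ->
  {for x, continuous f} -> {for x, continuous g} -> 0 < e ->
  exists2 r, 0 < r & forall y, ball x r y ->
    [/\ A y, `|f x - f y| < e & `|g x - g y| < e].
Proof.
move=> oA Ax cf cg e0.
have : \forall y \near x, [/\ A y, `|f x - f y| < e & `|g x - g y| < e].
  near=> y; split.
  - by near: y; exact: (open_nbhs_nbhs (conj oA Ax)).
  - by near: y; exact: cvgr_dist_lt cf _ e0.
  - by near: y; exact: cvgr_dist_lt cg _ e0.
by move=> /nbhs_ballP[r /= r0 br]; exists r.
Unshelve. all: by end_near. Qed.

(** Schwarz: the two orders of differentiation are values of the same second
    difference at points close to [x]. *)
Lemma derive2C A f x u v : open A -> A x -> smooth 2 A f ->
  'D_u ('D_v f) x = 'D_v ('D_u f) x.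
Proof.
move=> oA Ax sf; apply/eqP; rewrite -subr_eq0; apply/negPn/negP => ne.
set P := 'D_u ('D_v f); set Q := 'D_v ('D_u f).
rewrite -normr_gt0 -/P -/Q in ne.
have [e eE] : exists e, e = `|P x - Q x| by exists `|P x - Q x|.
rewrite -eE in ne.
have cP : {for x, continuous P}.
  exact: smooth_continuous (smooth_derive u (smooth_derive v sf)) Ax.
have cQ : {for x, continuous Q}.
  exact: smooth_continuous (smooth_derive v (smooth_derive u sf)) Ax.
have e2 : 0 < e / 2 by rewrite divr_gt0.
have [r r0 br] := ball_close oA Ax cP cQ e2.
pose s := r / (`|u| + `|v| + 1).
have v1 : 0 < `|u| + `|v| + 1 by rewrite ltr_wpDl// addr_ge0.
have s0 : 0 < s by rewrite divr_gt0.
have B t t' : 0 <= t <= s -> 0 <= t' <= s -> ball x r (t *: u + t' *: v + x).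
  move=> /andP[t0 ts] /andP[t'0 t's].
  rewrite -ball_normE /= opprD addrCA subrr addr0 normrN.
  rewrite (le_lt_trans (ler_normD _ _))// !normrZ !ger0_norm//.
  rewrite (@le_lt_trans _ _ (s * (`|u| + `|v|)))//.
    by rewrite mulrDr lerD// ler_wpM2r.
  rewrite /s mulrAC ltr_pdivrMr// ltr_pM2l// ltrDl//.
have [t [t' [t0 t'0 E]]] : exists t t', [/\ 0 < t < s, 0 < t' < s &
    f (s *: u + s *: v + x) - f (s *: u + x) - f (s *: v + x) + f x =
      s * (s * Q (t *: u + t' *: v + x))].
  by apply: (second_difference sf s0) => t t' ts t's; have [] := br _ (B t t' ts t's).
have [w [w' [w0 w'0 E']]] : exists t t', [/\ 0 < t < s, 0 < t' < s &
    f (s *: v + s *: u + x) - f (s *: v + x) - f (s *: u + x) + f x =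
      s * (s * P (t *: v + t' *: u + x))].
  apply: (second_difference sf s0) => t'' w ts t's; rewrite (addrC (_ *: v)).
  by have [] := br _ (B w t'' t's ts).
clearbody P Q.
have PQ : P (w *: v + w' *: u + x) = Q (t *: u + t' *: v + x).
  apply: (mulfI (lt0r_neq0 s0)); apply: (mulfI (lt0r_neq0 s0)).
  by rewrite -E -E' (addrC (s *: v)) ; congr (_ + _); rewrite addrAC.
have le01 z : 0 < z < s -> 0 <= z <= s by move=> /andP[z0 zs]; rewrite !ltW.
have [_ b1 _] := br _ (B w' w (le01 _ w'0) (le01 _ w0)).
have [_ _ b2] := br _ (B t t' (le01 _ t0) (le01 _ t'0)).
move: b1; rewrite (addrC (w' *: u)) PQ; move: (Q (_ + x)) b2 => c b2 b1.
have : e < e / 2 + e / 2.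
  rewrite [X in X < _]eE -(subrKA c) (le_lt_trans (ler_normD _ _))//.
  by rewrite ltrD// distrC.
by rewrite -splitr ltxx.
Qed.

End SecondOrder.

(** * Euclidean geometry of space *)

Section EuclideanSpace.
Context {R : realType}.
Implicit Types (x y z u v : 'rV[R]_3) (c : R).

Lemma sum3 (T : nmodType) (F : 'I_3 -> T) :
  \sum_(i < 3) F i = F 0 + F 1 + F 2%:R.
Proof.
rewrite !big_ord_recl big_ord0 addr0 addrA.
by congr (F _ + F _ + F _); apply: val_inj.
Qed.

Lemma dotE x y : dot x y = x 0 0 * y 0 0 + x 0 1 * y 0 1 + x 0 2%:R * y 0 2%:R.
Proof. exact: sum3. Qed.

Lemma dotC x y : dot x y = dot y x.
Proof. by apply: eq_bigr => i _; rewrite mulrC. Qed.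

Lemma dotDl x y z : dot (x + y) z = dot x z + dot y z.
Proof. by rewrite -big_split; apply: eq_bigr => i _; rewrite mxE mulrDl. Qed.

Lemma dotZl c x y : dot (c *: x) y = c * dot x y.
Proof. by rewrite mulr_sumr; apply: eq_bigr => i _; rewrite mxE mulrA. Qed.

Lemma dotDr x y z : dot z (x + y) = dot z x + dot z y.
Proof. by rewrite !(dotC z) dotDl. Qed.

Lemma dotZr c x y : dot y (c *: x) = c * dot y x.
Proof. by rewrite !(dotC y) dotZl. Qed.

Lemma dotNl x y : dot (- x) y = - dot x y.
Proof. by rewrite -scaleN1r dotZl mulN1r. Qed.

Lemma dotNr x y : dot x (- y) = - dot x y.
Proof. by rewrite dotC dotNl dotC. Qed.

Lemma dotBl x y z : dot (x - y) z = dot x z - dot y z.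
Proof. by rewrite dotDl dotNl. Qed.

Lemma dotBr x y z : dot z (x - y) = dot z x - dot z y.
Proof. by rewrite dotDr dotNr. Qed.

Lemma dot0l x : dot 0 x = 0.
Proof. by rewrite -(scale0r 0) dotZl mul0r. Qed.

Lemma dot_ge0 x : 0 <= dot x x.
Proof. by apply: sumr_ge0 => i _; rewrite -expr2 sqr_ge0. Qed.

Lemma dot_eq0 x : (dot x x == 0) = (x == 0).
Proof.
apply/idP/eqP => [|->]; last by rewrite dot0l.
rewrite psumr_eq0 => [/allP x0|i _]; last by rewrite -expr2 sqr_ge0.
apply/rowP => i; apply/eqP; rewrite mxE -sqrf_eq0 expr2.
by apply: x0; rewrite mem_index_enum.
Qed.

Lemma dot_gt0 x : (0 < dot x x) = (x != 0).
Proof. by rewrite lt0r dot_ge0 andbT dot_eq0. Qed.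

Lemma dot_delta x i : dot (delta_mx 0 i) x = x 0 i.
Proof.
rewrite /dot (bigD1 i)//= big1 => [|j ji].
  by rewrite mxE !eqxx mul1r addr0.
by rewrite mxE (negPf ji) andbF mul0r.
Qed.

(* Lagrange's identity. *)
Lemma dot_CauchySchwarz x y : dot x y ^+ 2 <= dot x x * dot y y.
Proof.
rewrite !dotE -subr_ge0.
set a := x 0 0; set b := x 0 1; set c := x 0 2%:R.
set d := y 0 0; set e := y 0 1; set f := y 0 2%:R.
have -> : (a * a + b * b + c * c) * (d * d + e * e + f * f) -
  (a * d + b * e + c * f) ^+ 2 =
  (a * e - b * d) ^+ 2 + (a * f - c * d) ^+ 2 + (b * f - c * e) ^+ 2 by ring.
by rewrite !addr_ge0 ?sqr_ge0.
Qed.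

Lemma enorm_ge0 x : 0 <= enorm x.
Proof. exact: sqrtr_ge0. Qed.

Lemma enorm_sqr x : enorm x ^+ 2 = dot x x.
Proof. by rewrite sqr_sqrtr ?dot_ge0. Qed.

Lemma enorm_gt0 x : (0 < enorm x) = (x != 0).
Proof. by rewrite sqrtr_gt0 dot_gt0. Qed.

Lemma enorm_eq0 x : (enorm x == 0) = (x == 0).
Proof. by rewrite -dot_eq0 -enorm_sqr sqrf_eq0. Qed.

Lemma enorm0 : enorm (0 : 'rV[R]_3) = 0.
Proof. by apply/eqP; rewrite enorm_eq0. Qed.

Lemma enormZ c x : enorm (c *: x) = `|c| * enorm x.
Proof.
by rewrite /enorm dotZl dotZr mulrA -expr2 sqrtrM ?sqr_ge0// sqrtr_sqr.
Qed.

Lemma enormN x : enorm (- x) = enorm x.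
Proof. by rewrite -scaleN1r enormZ normrN1 mul1r. Qed.

Lemma ler_dot x y : `|dot x y| <= enorm x * enorm y.
Proof.
rewrite -(@ler_pXn2r _ 2) ?nnegrE ?mulr_ge0 ?enorm_ge0//.
by rewrite real_normK ?num_real// exprMn !enorm_sqr dot_CauchySchwarz.
Qed.

Lemma ler_enormD x y : enorm (x + y) <= enorm x + enorm y.
Proof.
rewrite -(@ler_pXn2r _ 2) ?nnegrE ?addr_ge0 ?enorm_ge0//.
rewrite enorm_sqr dotDl !dotDr (dotC y x) sqrrD !enorm_sqr.
by have := ler_dot x y; have := ler_norm (dot x y); lra.
Qed.

Lemma ler_enormB x y : enorm x - enorm y <= enorm (x - y).
Proof. by rewrite lerBlDr -{1}(subrK y x) ler_enormD. Qed.

Lemma norm_le_enorm x : `|x| <= enorm x.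
Proof.
rewrite [leLHS]/Num.Def.normr /= mx_normrE; apply: bigmax_le; first exact: enorm_ge0.
move=> [i j] _ /=; rewrite ord1 -(dot_delta x j).
rewrite (le_trans (ler_dot _ _))// /enorm dot_delta mxE !eqxx.
by rewrite sqrtr1 mul1r.
Qed.

Lemma unit_vectorP x : unit_vector x <-> dot x x = 1.
Proof.
rewrite /unit_vector -enorm_sqr; split=> [->|/eqP]; first by rewrite expr1n.
by rewrite sqrf_eq1 => /predU1P[//|/eqP x1]; have := enorm_ge0 x; rewrite x1; lra.
Qed.

Lemma unit_vector_neq0 x : unit_vector x -> x != 0.
Proof. by rewrite -enorm_gt0 => ->. Qed.

Lemma is_derive_coord x u i : is_derive x u (fun y => y 0 i) (u 0 i).
Proof.
have did : derivable (id : 'rV[R]_3 -> 'rV[R]_3) x u by exact: derivable_id.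
apply: DeriveDef; first by have /derivable_mxP := did.
by have := derive_mx did; rewrite derive_id => /matrixP /(_ 0 i); rewrite mxE.
Qed.

Lemma is_derive_dot v x u : is_derive x u (dot v) (dot v u).
Proof.
have E : dot v = \sum_(i < 3) (fun y => v 0 i *: (y 0 i : R)).
  by apply/funext => y; rewrite fct_sumE.
have E2 : dot v u = \sum_(i < 3) (v 0 i *: (u 0 i : R)) by [].
rewrite E2 E.
by apply: is_derive_sum => i; apply: is_deriveZ; exact: is_derive_coord.
Qed.

Lemma dot_continuous v : continuous (dot v).
Proof.
have -> : dot v = (fun y => v 0 0 * y 0 0 + v 0 1 * y 0 1 + v 0 2%:R * y 0 2%:R).
  by apply/funext => y; rewrite dotE.
have c i : continuous (fun y : 'rV[R]_3 => v 0 i * y 0 i).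
  move=> x; apply: (@continuousM _ _ (cst (v 0 i)) (fun y => y 0 i)).
    exact: cst_continuous.
  exact: coord_continuous.
move=> x; apply: (@continuousD _ _ _ (fun y => v 0 0 * y 0 0 + v 0 1 * y 0 1)
  (fun y => v 0 2%:R * y 0 2%:R)); last exact: c.
by apply: (@continuousD _ _ _ (fun y => v 0 0 * y 0 0) (fun y => v 0 1 * y 0 1)); exact: c.
Qed.

Lemma smooth_dot k A v : smooth k A (dot v).
Proof.
case: k => [|k]; first by split=> // x _; exact: dot_continuous.
apply: smoothS => [x _|u x _|u]; first exact: dot_continuous.
  by case: (is_derive_dot v x u).
rewrite [X in smooth _ _ X](_ : _ = cst (dot v u)); first exact: smooth_cst.
by apply/funext => x; case: (is_derive_dot v x u).
Qed.

Lemma is_derive_sqr x u : is_derive x u (fun y => dot y y) (2 * dot u x).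
Proof.
have -> : (fun y => dot y y) =
    \sum_(i < 3) ((fun y : 'rV[R]_3 => y 0 i : R) * (fun y => y 0 i : R)).
  by apply/funext => y; rewrite fct_sumE.
have -> : 2 * dot u x = \sum_(i < 3) (x 0 i *: u 0 i + x 0 i *: u 0 i).
  by rewrite mulr_sumr; apply: eq_bigr => i _; rewrite /GRing.scale /=; ring.
by apply: is_derive_sum => i; apply: is_deriveM; exact: is_derive_coord.
Qed.

Lemma dotxx_continuous : continuous (fun y : 'rV[R]_3 => dot y y).
Proof.
have -> : (fun y : 'rV[R]_3 => dot y y) =
   (fun y => y 0 0 * y 0 0 + y 0 1 * y 0 1 + y 0 2%:R * y 0 2%:R).
  by apply/funext => y; rewrite dotE.
have c i : continuous (fun y : 'rV[R]_3 => y 0 i * y 0 i).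
  by move=> x; apply: (@continuousM _ _ (fun y => y 0 i) (fun y => y 0 i));
    exact: coord_continuous.
move=> x; apply: (@continuousD _ _ _ (fun y => y 0 0 * y 0 0 + y 0 1 * y 0 1)
  (fun y => y 0 2%:R * y 0 2%:R)); last exact: c.
by apply: (@continuousD _ _ _ (fun y => y 0 0 * y 0 0) (fun y => y 0 1 * y 0 1)); exact: c.
Qed.

Lemma enorm_continuous : continuous (@enorm R).
Proof.
move=> x; apply: (@continuous_comp _ _ _ (fun y => dot y y) Num.sqrt).
  exact: dotxx_continuous.
exact: sqrt_continuous.
Qed.

End EuclideanSpace.

(** * The Laplacian and the powers of the radius *)

Section Directions.
Context {R : realType} {V : normedModType R}.
Implicit Types (f g : V -> R) (x v b : V) (A : set V).

Lemma is_derive_scale f x v (c d : R) :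
  is_derive x v f d -> is_derive x (c *: v) f (c * d).
Proof.
have x0 w : x = 0 *: w + x by rewrite scale0r add0r.
move=> hf; rewrite (x0 (c *: v)); apply: (is_derive_line f x (c *: v) 0 _).2.
have -> : (fun h : R => f (h *: (c *: v) + x)) =
    (fun h : R => f (h *: v + x)) \o (fun h => h * c).
  by apply/funext => h /=; rewrite scalerA.
rewrite mulrC; apply: is_derive1_comp.
  by rewrite mul0r; apply: (is_derive_line f x v 0 d).1; rewrite -x0.
have -> : (fun h : R => h * c) = (fun h : R => c *: h).
  by apply/funext => h; rewrite mulrC.
by apply: is_derive_eq; exact: mulr1.
Qed.

Lemma derive_scale f x v (c : R) :
  derivable f x v -> 'D_(c *: v) f x = c * 'D_v f x.
Proof. by move=> /derivableP /(is_derive_scale c) []. Qed.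

Lemma derive_shift_arg f b v :
  'D_v (fun y => f (y + b)) = (fun x => 'D_v f (x + b)).
Proof.
have -> : (fun y => f (y + b)) = (fun y => f (1 *: y + b)).
  by apply/funext => y; rewrite scale1r.
by rewrite derive_affine; apply/funext => y; rewrite !scale1r.
Qed.

Lemma derive2_shift f b v x :
  'D_v ('D_v (fun y => f (y + b))) x = 'D_v ('D_v f) (x + b).
Proof.
have E : 'D_v (fun y => f (y + b)) = (fun x => 'D_v f (x + b)).
  exact: derive_shift_arg.
have E2 := congr1 (fun g => g x) (derive_shift_arg ('D_v f) b v).
transitivity ('D_v (fun y => 'D_v f (y + b)) x); last exact: E2.
by congr (derive _ x v).
Qed.

Lemma smooth_shift k A f b : smooth k A f ->
  smooth k ((fun x => x + b) @^-1` A) (fun x => f (x + b)).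
Proof.
move=> /(smooth_affine 1 b).
have -> : (fun x => 1 *: x + b) = (fun x => x + b).
  by apply/funext => y; rewrite scale1r.
have -> // : (fun x => f (1 *: x + b)) = (fun x => f (x + b)).
by apply/funext => y; rewrite scale1r.
Qed.

Lemma deriveM_mul f g x v : derivable f x v -> derivable g x v ->
  'D_v (fun y => f y * g y) x = f x * 'D_v g x + g x * 'D_v f x.
Proof. by move=> df dg; have := deriveM df dg. Qed.

Lemma derive2D A f g x v : open A -> A x -> smooth 2 A f -> smooth 2 A g ->
  'D_v ('D_v (fun y => f y + g y)) x = 'D_v ('D_v f) x + 'D_v ('D_v g) x.
Proof.
move=> oA Ax sf sg.
rewrite (@open_eq_derive _ _ _ _ (fun y => 'D_v f y + 'D_v g y) _ _ oA Ax).
  rewrite (@deriveD _ _ _ ('D_v f) ('D_v g))//.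
    exact: smooth_derivable (smooth_derive v sf) Ax.
  exact: smooth_derivable (smooth_derive v sg) Ax.
move=> y Ay; rewrite (@deriveD _ _ _ f g)//.
  exact: smooth_derivable sf Ay.
exact: smooth_derivable sg Ay.
Qed.

Lemma derive2Z A f (c : R) x v : open A -> A x -> smooth 2 A f ->
  'D_v ('D_v (fun y => c * f y)) x = c * 'D_v ('D_v f) x.
Proof.
move=> oA Ax sf.
rewrite (@open_eq_derive _ _ _ _ (fun y => c * 'D_v f y) _ _ oA Ax).
  rewrite (@deriveZ _ _ _ ('D_v f))//.
  exact: smooth_derivable (smooth_derive v sf) Ax.
move=> y Ay; rewrite (@deriveZ _ _ _ f)//.
exact: smooth_derivable sf Ay.
Qed.

Lemma derive2M A f g x v : open A -> A x -> smooth 2 A f -> smooth 2 A g ->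
  'D_v ('D_v (fun y => f y * g y)) x =
  f x * 'D_v ('D_v g) x + 2 * ('D_v f x * 'D_v g x) + g x * 'D_v ('D_v f) x.
Proof.
move=> oA Ax sf sg.
have df y : A y -> derivable f y v by exact: smooth_derivable sf.
have dg y : A y -> derivable g y v by exact: smooth_derivable sg.
have ddf : derivable ('D_v f) x v := smooth_derivable (smooth_derive v sf) Ax.
have ddg : derivable ('D_v g) x v := smooth_derivable (smooth_derive v sg) Ax.
rewrite (@open_eq_derive _ _ _ _ (fun y => f y * 'D_v g y + g y * 'D_v f y) _ _ oA Ax);
  last by move=> y Ay; exact: deriveM_mul (df _ Ay) (dg _ Ay).
have h1 : derivable (fun y => f y * 'D_v g y) x v := derivableM (df _ Ax) ddg.
have h2 : derivable (fun y => g y * 'D_v f y) x v := derivableM (dg _ Ax) ddf.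
have -> := deriveD h1 h2.
have -> := deriveM_mul (df _ Ax) ddg.
have -> := deriveM_mul (dg _ Ax) ddf.
move: ('D_v ('D_v f) x) ('D_v ('D_v g) x) ('D_v f x) ('D_v g x) (f x) (g x).
move=> a b c d e h; ring.
Qed.

End Directions.

Section Laplacian.
Context {R : realType}.
Local Notation V := 'rV[R]_3.
Implicit Types (f g : V -> R) (x y v b : V) (A : set V).

(** The Laplacian, as the trace of the second derivatives along the canonical
    basis. *)
Definition lap f x : R :=
  \sum_(i < 3) 'D_(delta_mx 0 i) ('D_(delta_mx 0 i) f) x.

Lemma lapD A f g x : open A -> A x -> smooth 2 A f -> smooth 2 A g ->
  lap (fun y => f y + g y) x = lap f x + lap g x.
Proof.
move=> oA Ax sf sg; rewrite /lap -big_split; apply: eq_bigr => i _.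
exact: derive2D sf sg.
Qed.

Lemma lapZ A f (c : R) x : open A -> A x -> smooth 2 A f ->
  lap (fun y => c * f y) x = c * lap f x.
Proof.
move=> oA Ax sf; rewrite /lap mulr_sumr; apply: eq_bigr => i _.
exact: derive2Z sf.
Qed.

Lemma lap_shift f b x : lap (fun y => f (y + b)) x = lap f (x + b).
Proof.
by apply: eq_bigr => i _; exact: derive2_shift.
Qed.

Lemma lap_local_max A f x : open A -> A x -> smooth 2 A f ->
  (\forall y \near x, f y <= f x) -> lap f x <= 0.
Proof.
move=> oA Ax sf fx; apply: sumr_le0 => i _.
exact: derive2_local_max oA Ax sf fx.
Qed.

(** Space without the origin. *)
Definition punctured : set V := [set x | x != 0].

Lemma open_punctured : open punctured.
Proof.
rewrite (_ : punctured = ~` [set 0]); last first.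
  by apply/seteqP; split=> x /=; [move/eqP|move=> ?; exact/eqP].
apply/closed_openC/accessible_closed_set1/hausdorff_accessible.
exact: norm_hausdorff.
Qed.

(** The function [|x|^(2 a)] of the Euclidean norm; the exponent bears on the
    squared norm. *)
Definition radial_power (a : R) x : R := dot x x `^ a.

Lemma is_derive_radial_power a x v : x != 0 ->
  is_derive x v (radial_power a) (2 * a * (dot v x * radial_power (a - 1) x)).
Proof.
rewrite -dot_gt0 => x0.
have h := is_derive_chain (is_derive_sqr x v) (is_derive1_powR a x0).
have <- : a * dot x x `^ (a - 1) * (2 * dot v x) =
  2 * a * (dot v x * radial_power (a - 1) x) by rewrite /radial_power; ring.
exact: h.
Qed.

Lemma radial_power_continuous a x : x != 0 -> {for x, continuous (radial_power a)}.
Proof.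
rewrite -dot_gt0 => x0.
have cs : {for x, continuous (fun y : V => dot y y)} by exact: dotxx_continuous.
have cp : {for dot x x, continuous (fun s : R => s `^ a)}.
  apply/differentiable_continuous/derivable1_diffP.
  by case: (is_derive1_powR a x0).
exact: continuous_comp cs cp.
Qed.

Lemma smooth_radial_power k a : smooth k punctured (radial_power a).
Proof.
elim: k a => [|k IH] a.
  by split=> // x; exact: radial_power_continuous.
apply: smoothS => [x|v x x0|v]; first exact: radial_power_continuous.
  by case: (is_derive_radial_power a v x0).
apply: (@smooth_ext _ _ _ _
  (fun x => 2 * a * (dot v x * radial_power (a - 1) x)) _ open_punctured).
  by move=> x x0; case: (is_derive_radial_power a v x0).
apply: smoothZ; first exact: open_punctured.
apply: smoothM; [exact: open_punctured|exact: smooth_dot|exact: IH].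
Qed.

Lemma sqr_radial_power a x : x != 0 ->
  dot x x * radial_power (a - 1) x = radial_power a x.
Proof.
rewrite -dot_gt0 /radial_power; move: (dot x x) => s s0.
have := @powRD R s 1 (a - 1); rewrite (gt_eqF s0) implybT => /(_ isT).
by rewrite powRr1 ?ltW// addrC subrK => ->.
Qed.

(** In dimension 3, [Lap |x|^m = m (m + 1) |x|^(m - 2)], here with [m = 2 a]. *)
Lemma lap_radial_power a x : x != 0 ->
  lap (radial_power a) x = 2 * a * (2 * a + 1) * radial_power (a - 1) x.
Proof.
move=> x0.
have E v : 'D_v ('D_v (radial_power a)) x = 2 * a * (dot v v * radial_power (a - 1) x
    + dot v x ^+ 2 * (2 * (a - 1)) * radial_power (a - 1 - 1) x).
  rewrite (@open_eq_derive _ _ _ _ (fun x => 2 * a * (dot v x * radial_power (a - 1) x))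
     _ _ open_punctured x0).
    have h := is_deriveZ (2 * a) (is_deriveM (is_derive_dot v x v)
      (is_derive_radial_power (a - 1) v x0)).
    rewrite [LHS](@derive_val _ _ _ _ _ _ _ h) /GRing.scale /=; ring.
  by move=> y y0; case: (is_derive_radial_power a v y0).
rewrite /lap; under eq_bigr => i _ do rewrite E.
rewrite -mulr_sumr big_split/=.
under eq_bigr => i _ do rewrite dot_delta mxE !eqxx mul1r.
rewrite sumr_const card_ord.
under eq_bigr => i _ do rewrite dot_delta -mulrA.
rewrite -mulr_suml.
have -> : \sum_(i < 3) x 0 i ^+ 2 = dot x x.
  by apply: eq_bigr => i _; rewrite expr2.
rewrite mulrCA sqr_radial_power//; ring.
Qed.

End Laplacian.

(** * Maximum principle and barrier *)

Section MaximumPrinciple.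
Context {R : realType}.
Local Notation V := 'rV[R]_3.
Implicit Types (f U : V -> R) (x y v a b : V) (A K : set V).

(** Maximum principle: a strictly subharmonic function on [A] that is
    nonpositive outside a compact subset is nonpositive, since it has no local
    maximum. *)
Lemma subharmonic_nonpos A K U : open A -> smooth 2 A U ->
  (forall x, A x -> 0 < lap U x) -> compact K -> K `<=` A ->
  (forall x, A x -> ~ K x -> U x <= 0) -> forall x, A x -> U x <= 0.
Proof.
move=> oA sU lU cK KA UK x0 Ax0; rewrite leNgt; apply/negP => Ux0.
have Kx0 : K x0 by apply: contrapT => /(UK _ Ax0); rewrite leNgt Ux0.
have cU : {within K, continuous U}.
  apply: continuous_in_subspaceT => x /set_mem /KA Ax.
  exact: smooth_continuous sU Ax.
have [c /set_mem Kc Umax] := @compact_EVT_max _ R U K (ex_intro _ _ Kx0) cK cU.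
have Uc : 0 < U c by apply: lt_le_trans Ux0 _; apply: Umax; rewrite inE.
have Umax' y : A y -> U y <= U c.
  move=> Ay; have [Ky|nKy] := pselect (K y); first by apply: Umax; rewrite inE.
  by apply: le_trans (UK y Ay nKy) _; exact: ltW.
have : lap U c <= 0.
  apply: (lap_local_max oA (KA _ Kc) sU).
  have nA : nbhs c A := open_nbhs_nbhs (conj oA (KA _ Kc)).
  exact: filterS Umax' nA.
by rewrite leNgt (lU _ (KA _ Kc)).
Qed.

Lemma compact_enorm (P : set V) (r : R) : closed P ->
  (forall x, P x -> enorm x <= r) -> compact P.
Proof.
move=> cP Pr; apply: bounded_closed_compact cP.
exists r; split; first exact: num_real.
by move=> M rM x Px /=; rewrite (le_trans (norm_le_enorm x))// (le_trans (Pr x Px))// ltW.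
Qed.

Lemma enorm_shift_continuous b : continuous (fun x : V => enorm (x + b)).
Proof.
move=> x; apply: (@continuous_comp _ _ _ (fun x : V => x + b) (@enorm R)).
  apply: (@continuousD _ _ _ id (cst b)); first exact: cvg_id.
  exact: cst_continuous.
exact: enorm_continuous.
Qed.

Lemma closed_enorm_le (r : R) b : closed [set x : V | enorm (x + b) <= r].
Proof.
by have /continuous_closedP/(_ _ (@closed_le R r)) := @enorm_shift_continuous b.
Qed.

Lemma closed_enorm_ge (r : R) b : closed [set x : V | r <= enorm (x + b)].
Proof.
by have /continuous_closedP/(_ _ (@closed_ge R r)) := @enorm_shift_continuous b.
Qed.

Lemma sphere_bounded f : (forall x, x != 0 -> {for x, continuous f}) ->
  exists C, 0 <= C /\ forall x, enorm x = 1 -> `|f x| <= C.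
Proof.
move=> cf; pose S := [set x : V | enorm x = 1].
have cS : compact S.
  apply: (@compact_enorm _ 1); last by move=> x ->.
  have -> : S = [set x : V | enorm (x + 0) <= 1] `&` [set x : V | 1 <= enorm (x + 0)].
    apply/seteqP; split=> x /=; rewrite addr0; first by move=> ->.
    by move=> [h1 h2]; apply/eqP; rewrite eq_le h1.
  by apply: closedI; [exact: closed_enorm_le|exact: closed_enorm_ge].
have S0 : S !=set0.
  exists (delta_mx 0 0); rewrite /S /= /enorm dot_delta mxE !eqxx.
  exact: sqrtr1.
have cg : {within S, continuous (fun x => `|f x|)}.
  apply: continuous_in_subspaceT => x /set_mem Sx.
  have x0 : x != 0 by rewrite -enorm_gt0 Sx.
  apply: (@continuous_comp _ _ _ f (fun t : R => `|t|)); first exact: cf.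
  exact: norm_continuous.
have [c _ cmax] := compact_EVT_max S0 cS cg.
exists `|f c|; split => // x x1; apply: cmax.
by rewrite inE.
Qed.

Lemma unit_decomp x : x != 0 -> exists n, enorm n = 1 /\ x = enorm x *: n.
Proof.
move=> x0; exists ((enorm x)^-1 *: x); rewrite enormZ.
have e0 : 0 < enorm x by rewrite enorm_gt0.
by rewrite gtr0_norm ?invr_gt0// mulVf ?gt_eqF// scalerA mulfV ?gt_eqF// scale1r.
Qed.

(** If scaling by [s] multiplies [f] by [k], then it multiplies the derivatives
    of [f] by [k / s]. *)
Lemma derive_homogeneous f (s k : R) x v : s != 0 -> x != 0 ->
  (forall y, y != 0 -> f (s *: y) = k * f y) ->
  (forall y, y != 0 -> derivable f y v) ->
  'D_v f (s *: x) = k / s * 'D_v f x.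
Proof.
move=> s0 x0 fs df.
have sx0 : s *: x != 0 by rewrite scaler_eq0 negb_or s0.
have E1 : 'D_v (fun y => f (s *: y + 0)) x = 'D_(s *: v) f (s *: x + 0).
  by have E := congr1 (fun g : V -> R => g x) (derive_affine f s 0 v).
have E2 : 'D_v (fun y => f (s *: y + 0)) x = 'D_v (fun y => k * f y) x.
  apply: open_eq_derive open_punctured x0 _ => y y0.
  by rewrite addr0 fs.
have E3 : 'D_v (fun y => k * f y) x = k * 'D_v f x by have := deriveZ k (df _ x0).
have E4 : 'D_(s *: v) f (s *: x + 0) = s * 'D_v f (s *: x).
  by rewrite addr0; apply: derive_scale; exact: df.
apply: (mulfI s0); rewrite -E4 -E1 E2 E3.
by move: ('D_v f x) => d; field.
Qed.

(** The function [|x|^(-1/2)].  The exponent lies strictly between -1 and 0, so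
    that the function is strictly superharmonic, infinite at the origin, and
    decays more slowly than [1 / |x|]. *)
Definition barrier : V -> R := radial_power (- 4^-1).

Lemma barrier_ge0 x : 0 <= barrier x.
Proof. exact: powR_ge0. Qed.

Lemma barrier_gt0 x : x != 0 -> 0 < barrier x.
Proof. by rewrite -dot_gt0 => x0; exact: powR_gt0. Qed.

Lemma barrier_sqr x : barrier x ^+ 2 = (enorm x)^-1.
Proof.
rewrite /barrier /radial_power -powR_mulrn ?powR_ge0// -powRrM.
have -> : - 4^-1 * 2%:R = - 2^-1 :> R by field.
by rewrite powRN powR12_sqrt ?dot_ge0.
Qed.

Lemma lap_barrier x : x != 0 -> lap barrier x < 0.
Proof.
move=> x0; rewrite lap_radial_power// pmulr_llt0; first by lra.
by apply: powR_gt0; rewrite dot_gt0.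
Qed.

Lemma barrier_large (L : R) x : 0 < L -> 0 < enorm x < L ^- 2 -> L <= barrier x.
Proof.
move=> L0 /andP[x0 xL]; have L0' := ltW L0.
rewrite -(@ler_pXn2r _ 2) ?nnegrE ?barrier_ge0//.
have L2 : 0 < L ^- 2 by rewrite invr_gt0 exprn_gt0.
by rewrite barrier_sqr -[L ^+ 2]invrK lef_pV2 ?posrE// ltW.
Qed.

Lemma barrier_small (L : R) x : 0 < L -> L ^- 2 < enorm x -> barrier x <= L.
Proof.
move=> L0 xL; have L0' := ltW L0.
rewrite -(@ler_pXn2r _ 2) ?nnegrE ?barrier_ge0//.
have L2 : 0 < L ^- 2 by rewrite invr_gt0 exprn_gt0.
rewrite barrier_sqr -[L ^+ 2]invrK lef_pV2 ?posrE//; first exact: ltW.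
exact: lt_trans xL.
Qed.

End MaximumPrinciple.

(** * Second differences of homogeneous functions *)

Section HomogeneousHarmonic.
Context {R : realType}.
Local Notation V := 'rV[R]_3.
Implicit Types (H : V -> R) (x y v a b : V) (A K : set V).

(** [H (x + a) - 2 H x + H (x - a)]. *)
Definition second_diff H a x : R := H (x + a) + (H (x + - a) + -2 * H x).

(** Space without the three poles [0], [- a] and [a] of [second_diff H a]. *)
Definition off_poles a : set V :=
  [set x | x != 0] `&` ([set x | x + a != 0] `&` [set x | x + - a != 0]).

(** The sum of the barriers centred at the three poles. *)
Definition pole_barrier a x : R := barrier (x + a) + (barrier (x + - a) + barrier x).

Lemma open_shift_punctured b : open [set x : V | x + b != 0].
Proof.
have cs : continuous (fun x : V => x + b).
  move=> x; apply: (@continuousD _ _ _ id (cst b)); first exact: cvg_id.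
  exact: cst_continuous.
by have /continuousP/(_ _ (@open_punctured R)) := cs.
Qed.

Lemma open_off_poles a : open (off_poles a).
Proof.
by apply: openI; [exact: open_punctured|apply: openI; exact: open_shift_punctured].
Qed.

Lemma smooth_off_poles f a : smooth 2 punctured f ->
  [/\ smooth 2 (off_poles a) (fun x => f (x + a)),
      smooth 2 (off_poles a) (fun x => f (x + - a)) &
      smooth 2 (off_poles a) f].
Proof.
move=> sf; split.
- by apply: smooth_sub (smooth_shift a sf) => x [_ []].
- by apply: smooth_sub (smooth_shift (- a) sf) => x [_ []].
- by apply: smooth_sub sf => x [].
Qed.

Lemma smooth_second_diff H a : smooth 2 punctured H ->
  smooth 2 (off_poles a) (second_diff H a).
Proof.
move=> /(smooth_off_poles a)[s1 s2 s3]; have oA : open (off_poles a) by exact: open_off_poles.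
exact: (smoothD oA s1 (smoothD oA s2 (smoothZ (-2) oA s3))).
Qed.

Lemma lap_second_diff H a x : smooth 2 punctured H -> off_poles a x ->
  lap (second_diff H a) x = lap H (x + a) + (lap H (x + - a) + -2 * lap H x).
Proof.
move=> /(smooth_off_poles a)[s1 s2 s3] Ax; have oA : open (off_poles a) by exact: open_off_poles.
have s4 : smooth 2 (off_poles a) (fun x => -2 * H x) by exact: (smoothZ (-2) oA s3).
have s5 : smooth 2 (off_poles a) (fun x => H (x + - a) + -2 * H x).
  exact: (smoothD oA s2 s4).
have E1 := lapD oA Ax s1 s5; have E2 := lapD oA Ax s2 s4.
have E3 := lapZ (-2) oA Ax s3.
have E4 := lap_shift H a x; have E5 := lap_shift H (- a) x.
transitivity (lap (fun x => H (x + a)) x +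
    lap (fun x => H (x + - a) + -2 * H x) x); first exact: E1.
exact: (congr2 +%R E4 (etrans E2 (congr2 +%R E5 E3))).
Qed.

Lemma smooth_pole_barrier a : smooth 2 (off_poles a) (pole_barrier a).
Proof.
have sb : smooth 2 punctured (@barrier R) by exact: smooth_radial_power.
have [s1 s2 s3] := smooth_off_poles a sb; have oA : open (off_poles a) by exact: open_off_poles.
exact: (smoothD oA s1 (smoothD oA s2 s3)).
Qed.

Lemma lap_pole_barrier a x : off_poles a x -> lap (pole_barrier a) x < 0.
Proof.
have sb : smooth 2 punctured (@barrier R) by exact: smooth_radial_power.
have [s1 s2 s3] := smooth_off_poles a sb; have oA : open (off_poles a) by exact: open_off_poles.
move=> Ax.
have s4 : smooth 2 (off_poles a) (fun x => barrier (x + - a) + barrier x).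
  exact: (smoothD oA s2 s3).
have E1 := lapD oA Ax s1 s4; have E2 := lapD oA Ax s2 s3.
have E4 := lap_shift (@barrier R) a x; have E5 := lap_shift (@barrier R) (- a) x.
have -> : lap (pole_barrier a) x = lap barrier (x + a) + (lap barrier (x + - a) +
    lap barrier x).
  exact: etrans E1 (congr2 +%R E4 (etrans E2 (congr2 +%R E5 erefl))).
case: Ax => x0 [x1 x2].
move: (lap_barrier x0) (lap_barrier x1) (lap_barrier x2).
move: (lap barrier x) (lap barrier (x + a)) (lap barrier (x + - a)).
move=> p q r p0 q0 r0; clear - p0 q0 r0; lra.
Qed.

Lemma pole_barrier_ge a x :
  [/\ barrier (x + a) <= pole_barrier a x, barrier (x + - a) <= pole_barrier a x
    & barrier x <= pole_barrier a x].
Proof.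
have := barrier_ge0 x; have := barrier_ge0 (x + a); have := barrier_ge0 (x + - a).
rewrite /pole_barrier; move: (barrier x) (barrier (x + a)) (barrier (x + - a)).
by move=> p q r p0 q0 r0; split; lra.
Qed.

Section Homogeneous.
Variable H : V -> R.
Hypothesis sH : smooth 2 punctured H.
Hypothesis homH : forall (s : R) x, 0 < s -> H (s *: x) = s * H x.

Lemma homogeneous_linear_bound :
  exists C, 0 <= C /\ forall x, `|H x| <= C * enorm x.
Proof.
have [C [C0 HC]] := sphere_bounded (fun x => @smooth_continuous _ _ _ _ _ x sH).
exists C; split => // x; have [->|x0] := eqVneq x 0.
  have : H (2 *: 0) = 2 * H 0 by exact: homH.
  rewrite scaler0 => h; have -> : H 0 = 0 by lra.
  by rewrite enorm0 normr0 mulr0.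
have [n [n1 ->]] := unit_decomp x0.
have e0 : 0 < enorm x by rewrite enorm_gt0.
rewrite homH// enormZ normrM n1 mulr1 mulrC ler_wpM2r//.
exact: HC.
Qed.

Lemma derive2_homogeneous (s : R) x v : 0 < s -> x != 0 ->
  'D_v ('D_v H) (s *: x) = s^-1 * 'D_v ('D_v H) x.
Proof.
move=> s0 x0; have sn0 : s != 0 by rewrite gt_eqF.
have s1 := smooth_derive v sH.
have E1 y : y != 0 -> 'D_v H (s *: y) = 1 * 'D_v H y.
  move=> y0; rewrite -(@divff _ s)//.
  apply: derive_homogeneous => // z z0; first exact: homH.
  exact: smooth_derivable sH z0.
rewrite -[s^-1]mul1r; apply: derive_homogeneous => // z z0.
exact: smooth_derivable s1 z0.
Qed.

Lemma homogeneous_hessian_bound v :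
  exists C, 0 <= C /\ forall x, x != 0 -> `|'D_v ('D_v H) x| <= C / enorm x.
Proof.
have s2 := smooth_derive v (smooth_derive v sH).
have [C [C0 HC]] := sphere_bounded (fun x => @smooth_continuous _ _ _ _ _ x s2).
exists C; split => // x x0.
have [n [n1 xn]] := unit_decomp x0; rewrite xn.
have e0 : 0 < enorm x by rewrite enorm_gt0.
have n0 : n != 0 by rewrite -enorm_gt0 n1.
have -> := derive2_homogeneous v e0 n0.
rewrite enormZ n1 mulr1 normrM normfV mulrC.
by apply: ler_wpM2r; [rewrite invr_ge0|exact: HC].
Qed.

Lemma far_point a x (s : R) : 2 * enorm a <= enorm x -> -1 <= s <= 1 ->
  enorm x / 2 <= enorm (x + s *: a).
Proof.
move=> xa s1; have := ler_enormB x (- (s *: a)).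
rewrite opprK enormN enormZ; apply: le_trans.
have s1' : `|s| <= 1 by rewrite ler_norml.
have : `|s| * enorm a <= 1 * enorm a by rewrite ler_wpM2r ?enorm_ge0.
by rewrite mul1r; move: (enorm x) (enorm a) (`|s| * _) xa => p q r; lra.
Qed.

(** Decay at infinity: [second_diff H a x] is a second derivative of [H] in the
    direction [a] at a point of norm at least [|x| / 2], and the second
    derivatives are homogeneous of degree -1. *)
Lemma second_diff_bound a : a != 0 -> exists C, 0 < C /\
  forall x, 2 * enorm a <= enorm x -> `|second_diff H a x| <= C / enorm x.
Proof.
rewrite -enorm_gt0 => a0; have [C [C0 HC]] := homogeneous_hessian_bound a.
exists (2 * C + 1); split; first by lra.
move=> x xa; have x0 : 0 < enorm x by apply: lt_le_trans xa; rewrite mulr_gt0.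
have P (t t' : R) : 0 <= t <= 1 -> 0 <= t' <= 1 ->
    enorm x / 2 <= enorm (t *: a + t' *: a + (x + - a)).
  move=> t1 t'1; have -> : t *: a + t' *: a + (x + - a) = x + (t + t' - 1) *: a.
    by rewrite scalerBl scalerDl scale1r addrCA.
  by apply: far_point => //; lra.
have P0 (t t' : R) : 0 <= t <= 1 -> 0 <= t' <= 1 ->
    punctured (t *: a + t' *: a + (x + - a)).
  move=> t1 t'1; rewrite /punctured /= -enorm_gt0.
  by apply: lt_le_trans (P t t' t1 t'1); rewrite divr_gt0.
have [t [t' [t1 t'1 E]]] := second_difference sH ltr01 P0.
have ty : 0 <= t <= 1 by move: t1 => /andP[? ?]; rewrite !ltW.
have t'y : 0 <= t' <= 1 by move: t'1 => /andP[? ?]; rewrite !ltW.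
have -> : second_diff H a x = 'D_a ('D_a H) (t *: a + t' *: a + (x + - a)).
  move: E; rewrite !mul1r => <-; rewrite !scale1r /second_diff.
  have -> : a + a + (x + - a) = x + a by rewrite addrC addrA subrK.
  have -> : a + (x + - a) = x by rewrite addrC subrK.
  by move: (H (x + a)) (H (x + - a)) (H x) => p q r; ring.
move: (P t t' ty t'y) (P0 t t' ty t'y); move: (_ + _) => y yx y0.
apply: le_trans (HC y y0) _.
have ey : 0 < enorm y by rewrite enorm_gt0.
rewrite ler_pdivrMr// mulrAC ler_pdivlMr//.
have := ler_wpM2l C0 yx; move: (C * enorm y) => q.
by move: (enorm x) (enorm y) x0 ey yx => p r *; nra.
Qed.

End Homogeneous.
End HomogeneousHarmonic.

(** * Even harmonic functions of degree one *)

Section HarmonicVanishing.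
Context {R : realType}.
Local Notation V := 'rV[R]_3.
Implicit Types (H : V -> R) (x y v a b : V) (A K : set V).

Section Comparison.
Variable H : V -> R.
Hypothesis sH : smooth 2 punctured H.
Hypothesis homH : forall (s : R) x, 0 < s -> H (s *: x) = s * H x.

Lemma second_diff_local_bound a (r : R) : exists M, 0 < M /\
  forall x, enorm x <= r -> second_diff H a x <= M.
Proof.
have [C [C0 HC]] := homogeneous_linear_bound sH homH.
have Ch y (q : R) : enorm y <= q -> `|H y| <= C * q.
  by move=> yq; apply: le_trans (HC y) _; exact: ler_wpM2l.
exists (`|C * (r + enorm a) + (C * (r + enorm a) + 2 * (C * r))| + 1); split.
  by rewrite ltr_wpDl.
move=> x xr.
have h1 : `|H (x + a)| <= C * (r + enorm a).
  by apply: Ch; apply: le_trans (ler_enormD x a) _; rewrite lerD2r.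
have h2 : `|H (x + - a)| <= C * (r + enorm a).
  by apply: Ch; apply: le_trans (ler_enormD x (- a)) _; rewrite enormN lerD2r.
have h3 := Ch x r xr.
rewrite /second_diff; move: h1 h2 h3.
move: (H (x + a)) (H (x + - a)) (H x) (C * (r + enorm a)) (C * r) => p q s t u.
rewrite !ler_norml => /andP[_ p1] /andP[_ q1] /andP[s1 _].
by apply: le_trans (_ : t + (t + 2 * u) <= _); [lra|have := ler_norm (t + (t + 2 * u)); lra].
Qed.

Lemma second_diff_far a (e : R) : a != 0 -> 0 < e -> exists r, 0 < r /\
  forall x, r < enorm x -> second_diff H a x <= e * barrier x.
Proof.
move=> a0 e0; have [C [C0 HC]] := second_diff_bound sH homH a0.
have q0 : 0 < e / C by rewrite divr_gt0.
have q2 : 0 < (e / C) ^- 2 by rewrite invr_gt0 exprn_gt0.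
exists (2 * enorm a + (e / C) ^- 2); split.
  by rewrite ltr_wpDl// mulr_ge0 ?enorm_ge0.
move=> x rx.
have xa : 2 * enorm a <= enorm x.
  by apply: le_trans (ltW rx); rewrite lerDl ltW.
have xb : (e / C) ^- 2 < enorm x.
  by apply: le_lt_trans rx; rewrite lerDr mulr_ge0 ?enorm_ge0.
apply: le_trans (ler_norm _) _; apply: le_trans (HC x xa) _.
rewrite -barrier_sqr expr2 mulrA ler_wpM2r ?barrier_ge0//.
by rewrite mulrC -ler_pdivlMr// barrier_small.
Qed.

Hypothesis lapH : forall x, x != 0 -> lap H x = 0.

(** The function [second_diff H a - e * pole_barrier a] is strictly subharmonic
    off the poles, and nonpositive near the poles and far away. *)
Lemma second_diff_le_barrier a (e : R) : a != 0 -> 0 < e ->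
  forall x, off_poles a x -> second_diff H a x <= e * pole_barrier a x.
Proof.
move=> a0 e0.
have oA : open (off_poles a) by exact: open_off_poles.
have [r [r0 far]] := second_diff_far a0 e0.
have [M [M0 near0]] := second_diff_local_bound a r.
have L0 : 0 < M / e by rewrite divr_gt0.
(* Within the distance d of a pole, e times its barrier exceeds M. *)
set d : R := (M / e) ^- 2.
have d0 : 0 < d by rewrite invr_gt0 exprn_gt0.
have near_pole x y : enorm x <= r -> y != 0 -> enorm y < d ->
    barrier y <= pole_barrier a x -> second_diff H a x <= e * pole_barrier a x.
  move=> xr; rewrite -enorm_gt0 => y0 yd yB; apply: le_trans (near0 x xr) _.
  rewrite mulrC -ler_pdivrMr//; apply: le_trans yB.
  by apply: barrier_large => //; rewrite y0.
pose K := [set x : V | enorm (x + 0) <= r] `&` [set x | d <= enorm (x + 0)] `&`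
  [set x | d <= enorm (x + a)] `&` [set x | d <= enorm (x + - a)].
have cK : compact K.
  apply: (@compact_enorm _ _ r); last by move=> x [[[]]] /=; rewrite addr0.
  by do 3 (apply: closedI; last exact: closed_enorm_ge); exact: closed_enorm_le.
have KA : K `<=` off_poles a.
  move=> x [[[/= _]]]; rewrite addr0 => x1 x2 x3.
  by split; [|split]; rewrite /= -enorm_gt0 (lt_le_trans d0).
pose U x := second_diff H a x + (- e) * pole_barrier a x.
have s1 : smooth 2 (off_poles a) (second_diff H a) := smooth_second_diff a sH.
have s2 : smooth 2 (off_poles a) (pole_barrier a) by exact: smooth_pole_barrier.
have s3 : smooth 2 (off_poles a) (fun x => (- e) * pole_barrier a x) := smoothZ (- e) oA s2.
have sU : smooth 2 (off_poles a) U := smoothD oA s1 s3.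
have lU x : off_poles a x -> 0 < lap U x.
  move=> Ax; have -> : lap U x = 0 + (- e) * lap (pole_barrier a) x.
    apply: etrans (lapD oA Ax s1 s3) (congr2 +%R _ (lapZ (- e) oA Ax s2)).
    apply: etrans (lap_second_diff sH Ax) _; case: Ax => x0 [x1 x2].
    by rewrite (lapH x0) (lapH x1) (lapH x2) mulr0 !addr0.
  by rewrite add0r mulNr oppr_gt0 pmulr_rlt0// lap_pole_barrier.
have UK x : off_poles a x -> ~ K x -> U x <= 0.
  move=> [x0 [x1 x2]] nK; rewrite /U mulNr subr_le0.
  have [B1 B2 B3] := pole_barrier_ge a x.
  have [xr|rx] := leP (enorm x) r; last first.
    by apply: le_trans (far x rx) _; rewrite ler_pM2l.
  have [xd|dx] := ltP (enorm x) d; first exact: near_pole xr x0 xd B3.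
  have [xd1|dx1] := ltP (enorm (x + a)) d; first exact: near_pole xr x1 xd1 B1.
  have [xd2|dx2] := ltP (enorm (x + - a)) d; first exact: near_pole xr x2 xd2 B2.
  by case: nK; rewrite /K /= addr0.
move=> x Ax; have := subharmonic_nonpos oA sU lU cK KA UK Ax.
by rewrite /U mulNr subr_le0.
Qed.

Lemma second_diff_nonpos a x : a != 0 -> off_poles a x -> second_diff H a x <= 0.
Proof.
move=> a0 Ax; rewrite leNgt; apply/negP => D0.
have [_ _ Bx] := pole_barrier_ge a x.
have B0 : 0 < pole_barrier a x by apply: lt_le_trans Bx; case: Ax => /barrier_gt0.
have e0 : 0 < second_diff H a x / 2 / pole_barrier a x by rewrite !divr_gt0.
have := second_diff_le_barrier a0 e0 Ax.
rewrite divfK ?gt_eqF//; move: (second_diff H a x) D0 => p p0 pp.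
by clear - p0 pp; lra.
Qed.

End Comparison.

(** An even function, homogeneous of degree 1 and harmonic off the origin,
    vanishes there. *)
Theorem even_harmonic_eq0 H : smooth 2 punctured H ->
  (forall (s : R) x, 0 < s -> H (s *: x) = s * H x) ->
  (forall x, x != 0 -> lap H x = 0) ->
  (forall x, H (- x) = H x) ->
  forall x, x != 0 -> H x = 0.
Proof.
move=> sH homH lapH evenH a a0.
have Ax : off_poles a (2^-1 *: a).
  have half : 2^-1 *: a + - a = - (2^-1 *: a).
    by rewrite -[X in _ - X]scale1r -scalerBl -scaleNr; congr (_ *: _); field.
  rewrite /off_poles /= half oppr_eq0.
  have -> : 2^-1 *: a + a = (2^-1 + 1) *: a by rewrite scalerDl scale1r.
  have h1 : 2^-1 != 0 :> R by rewrite invr_eq0 pnatr_eq0.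
  have h2 : 2^-1 + 1 != 0 :> R by rewrite gt_eqF// addr_gt0 ?invr_gt0.
  by rewrite !scaler_eq0 !negb_or h1 h2 a0.
(* At a / 2, the second difference is (3/2 + 1/2 - 1) G a. *)
have DE (G : V -> R) : (forall (s : R) x, 0 < s -> G (s *: x) = s * G x) ->
    (forall x, G (- x) = G x) -> second_diff G a (2^-1 *: a) = G a.
  move=> homG evenG; rewrite /second_diff.
  have -> : 2^-1 *: a + a = (2^-1 + 1) *: a by rewrite scalerDl scale1r.
  have -> : 2^-1 *: a + - a = - (2^-1 *: a).
    by rewrite -[X in _ - X]scale1r -scalerBl -scaleNr; congr (_ *: _); field.
  rewrite evenG !homG ?invr_gt0 ?addr_gt0 ?invr_gt0//.
  by move: (G a) => g; field.
have h1 : H a <= 0.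
  by rewrite -(DE H homH evenH); exact: second_diff_nonpos.
pose G x := -1 * H x.
have sG : smooth 2 punctured G := smoothZ (-1) (@open_punctured R) sH.
have homG (s : R) x : 0 < s -> G (s *: x) = s * G x.
  by move=> s0; rewrite /G homH// mulrCA.
have lapG x : x != 0 -> lap G x = 0.
  move=> x0; apply: etrans (lapZ (-1) (@open_punctured R) x0 sH) _.
  by rewrite lapH// mulr0.
have evenG x : G (- x) = G x by rewrite /G evenH.
have h2 : G a <= 0.
  by rewrite -(DE G homG evenG); exact: second_diff_nonpos.
by apply/eqP; rewrite eq_le h1 /=; move: h2; rewrite /G mulN1r oppr_le0.
Qed.

End HarmonicVanishing.

(** * Boundary of a convex body near a point *)

Section OutwardNormal.
Context {R : realType}.
Local Notation V := 'rV[R]_3.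
Implicit Types (x y z v nu mu : V) (K Sigma : set V).

Lemma convex_setP K (l : R) x y : convex_set K -> K x -> K y -> 0 <= l <= 1 ->
  K (l *: x + (1 - l) *: y).
Proof.
move=> cK Kx Ky /andP[l0 l1].
have := cK x y (Itv01 l0 l1); rewrite !inE => /(_ Kx Ky).
by [].
Qed.

(** The last point of a ray in a compact set is not interior to it. *)
Lemma ray_boundary K z (s : R) : compact K -> z != 0 -> K (s *: z) ->
  exists c, [/\ s <= c, K (c *: z) & ~ K° (c *: z)].
Proof.
move=> cK z0 Ks.
have clK : closed K by apply: compact_closed cK; exact: norm_hausdorff.
have [M [_ HM]] := compact_bounded cK.
have z0' : 0 < `|z| by rewrite normr_gt0.
pose T := (fun c : R => c *: z) @^-1` K `&` `[s, (`|M| + 1) / `|z|]%classic.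
have cz : continuous (fun c : R => c *: z) by exact: scalel_continuous.
have cT : compact T.
  apply: (@subclosed_compact _ _ `[s, (`|M| + 1) / `|z|]%classic).
  - apply: closedI; last exact: interval_closed.
    by have /continuous_closedP/(_ _ clK) := cz.
  - exact: segment_compact.
  - by move=> c [].
have KT c : s <= c -> K (c *: z) -> T c.
  move=> sc Kc; split => //=; rewrite in_itv/= sc ler_pdivlMr//.
  have M1 : M < `|M| + 1 by rewrite (le_lt_trans (ler_norm _))// ltrDl.
  have := HM _ M1 _ Kc; rewrite /= normrZ; apply: le_trans.
  by rewrite ler_wpM2r// ler_norm.
have Ts : T s by exact: KT.
have cid : {within T, continuous (fun c : R => c)}.
  by apply: continuous_subspaceT => c; exact: cvg_id.
have [c /set_mem Tc cmax] := compact_EVT_max (ex_intro _ _ Ts) cT cid.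
have sc : s <= c by apply: cmax; rewrite inE.
exists c; split => //; first by case: Tc.
move=> Kc.
have : nbhs (c *: z) K by exact: Kc.
move=> /cz /nbhs_ballP[e /= e0 be].
have e2 : 0 < e / 2 by rewrite divr_gt0.
have Kce : K ((c + e / 2) *: z).
  apply: be; rewrite -ball_normE /= opprD addNKr normrN gtr0_norm//.
  by rewrite ltr_pdivrMr// mulr2n mulrDr mulr1 ltrDl.
have : c + e / 2 <= c.
  by apply: cmax; rewrite inE; apply: KT Kce; rewrite (le_trans sc)// lerDl ltW.
by rewrite gerDl leNgt e2.
Qed.

Lemma interior_enorm_ball K : K° 0 -> exists r, 0 < r /\
  forall y, enorm y <= r -> K y.
Proof.
move=> /nbhs_ballP[e /= e0 be]; exists (e / 2); split; first by rewrite divr_gt0.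
move=> y ye; apply: be; rewrite -ball_normE /= sub0r normrN.
apply: le_lt_trans (norm_le_enorm y) _; apply: le_lt_trans ye _.
by rewrite ltr_pdivrMr// mulr2n mulrDr mulr1 ltrDl.
Qed.

Lemma tangent_plane_secant Sigma x nu (e : R) : tangent_plane Sigma x nu ->
  0 < e -> exists d, 0 < d /\ forall y, Sigma y -> enorm (y - x) < d ->
    `|dot (y - x) nu| <= e * enorm (y - x).
Proof.
move=> [Sx _ lim0] e0.
have /cvgrPdist_lt/(_ e e0) := lim0.
move=> h.
have {h} : nbhs x (fun y : V => y != x -> Sigma y ->
   `|0 - dot (y - x) nu / enorm (y - x)| < e).
  exact: h.
move=> /nbhs_ballP[d /= d0 bd]; exists d; split => // y Sy yd.
have [->|yx] := eqVneq y x; first by rewrite subrr dot0l normr0 enorm0 mulr0.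
have e1 : 0 < enorm (y - x) by rewrite enorm_gt0 subr_eq0.
have := bd y _ yx Sy; rewrite sub0r normrN normrM normfV (ger0_norm (enorm_ge0 _)).
rewrite ltr_pdivrMr// => h; apply/ltW/h.
by rewrite -ball_normE /= distrC; apply: le_lt_trans yd; exact: norm_le_enorm.
Qed.

Lemma outward_normal_pos K Sigma x nu : compact K -> K° 0 ->
  (forall y, Sigma y <-> K y /\ ~ K° y) ->
  outward_normal Sigma x nu -> 0 < dot x nu.
Proof.
move=> cK K0 SK [[Sx nu1 _] out].
have [r [r0 br]] := interior_enorm_ball K0.
have Kr : K (r *: nu) by apply: br; rewrite enormZ nu1 mulr1 gtr0_norm.
have [c [rc Kc nKc]] := ray_boundary cK (unit_vector_neq0 nu1) Kr.
have := out (c *: nu) ((SK _).2 (conj Kc nKc)).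
rewrite dotBl dotZl ((unit_vectorP nu).1 nu1) mulr1 subr_le0.
exact/lt_le_trans/(lt_le_trans r0).
Qed.

(** The ray through [x + t v] meets the boundary at [s (x + t v)] with
    [s - 1 = O(t)].  The lower bound on [s] comes from the convex hull of [x] and
    a ball about the origin, the upper bound from the supporting plane at [x]. *)
Lemma boundary_curve K Sigma x nu v : convex_set K -> compact K -> K° 0 ->
  (forall y, Sigma y <-> K y /\ ~ K° y) -> outward_normal Sigma x nu ->
  exists L t0, [/\ 0 <= L, 0 < t0 & forall t : R, 0 < t <= t0 ->
    exists s, [/\ Sigma (s *: (x + t *: v)), `|s - 1| <= L * t & 2^-1 <= s]].
Proof.
move=> convK cK K0 SK onu; have xnu := outward_normal_pos cK K0 SK onu.
have [[Sx nu1 _] out] := onu; have [r [r0 br]] := interior_enorm_ball K0.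
have [c cE] : exists c, c = enorm v by exists (enorm v).
have c0 : 0 <= c by rewrite cE enorm_ge0.
have [al alE] : exists al, al = dot x nu by exists (dot x nu).
rewrite -alE in xnu.
have kc : `|dot v nu| <= c by have := ler_dot v nu; rewrite nu1 mulr1 cE.
exists (c / r + 2 * c / al), (1 + 2 * c / r + 2 * c / al)^-1.
have cr : 0 <= c / r by rewrite divr_ge0 // ltW.
have cal : 0 <= c / al by rewrite divr_ge0 // ltW.
have D0 : 0 < 1 + 2 * c / r + 2 * c / al.
  by rewrite -!mulrA; lra.
split; [by rewrite -!mulrA; lra|by rewrite invr_gt0|].
move=> t /andP[t0]; rewrite -[X in t <= X]mul1r ler_pdivlMr// => tD.
have tr : t * c / r <= 2^-1.
  move: tD; rewrite -!mulrA !mulrDr.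
  have h1 : 0 <= t * (c / r) by rewrite mulr_ge0// ltW.
  have h2 : 0 <= t * (c / al) by rewrite mulr_ge0// ltW.
  rewrite (mulrCA t 2) (mulrCA t 2); move: (t * _) (t * _) h1 h2 => p q *; lra.
have ta : t * c / al <= 2^-1.
  move: tD; rewrite -!mulrA !mulrDr.
  have h1 : 0 <= t * (c / r) by rewrite mulr_ge0// ltW.
  have h2 : 0 <= t * (c / al) by rewrite mulr_ge0// ltW.
  rewrite (mulrCA t 2) (mulrCA t 2); move: (t * (c / r)) (t * (c / al)) h1 h2.
  by move=> p q *; lra.
have [l lE] : exists l, l = t * c / r by exists (t * c / r).
have l0 : 0 <= l by rewrite lE -mulrA mulr_ge0// ltW.
have lh : l <= 2^-1 by rewrite lE.
have l1 : 0 <= 1 - l by move: (l) lh => q qh; lra.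
have Kx : K x by case: ((SK x).1 Sx).
have Kb : K ((1 - l) *: (x + t *: v)).
  have [l00|ln0] := eqVneq l 0.
    have c00 : t *: v = 0.
      apply/eqP; rewrite -enorm_eq0 enormZ gtr0_norm// -cE.
      by move/eqP: l00; rewrite lE mulf_eq0 invr_eq0 (gt_eqF r0) orbF.
    by rewrite l00 subr0 scale1r c00 addr0.
  have lp : 0 < l by rewrite lt0r ln0.
  have Kb : K (((1 - l) * t / l) *: v).
    apply: br; rewrite enormZ ger0_norm; last first.
      by rewrite divr_ge0// mulr_ge0 ?(ltW t0).
    have rl : r * l = t * c by rewrite lE mulrC divfK ?gt_eqF.
    rewrite mulrAC ler_pdivrMr// -cE rl -mulrA.
    by apply: ler_piMl; [rewrite mulr_ge0// ltW|rewrite gerDl oppr_le0].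
  have l01 : 0 <= l <= 1 by move: (l) l0 lh => q q0 qh; lra.
  have := convex_setP convK Kb Kx l01.
  rewrite scalerA mulrCA divff// mulr1 scalerDr scalerA.
  by rewrite addrC.
have tv : `|dot (t *: v) nu| <= al / 2.
  rewrite dotZl normrM gtr0_norm//.
  apply: le_trans (_ : t * c <= _); first by rewrite ler_wpM2l// ltW.
  by move: ta; rewrite ler_pdivrMr// [_ / 2]mulrC.
have znu : 0 < dot (x + t *: v) nu.
  rewrite dotDl -alE; move: tv; move: (dot (t *: v) nu) => k.
  by rewrite ler_norml => /andP[k1 k2]; lra.
have z0 : x + t *: v != 0 by apply: contraTneq znu => ->; rewrite dot0l ltxx.
have [s [ls Ss]] : exists s, 1 - l <= s /\ Sigma (s *: (x + t *: v)).
  have [s [ls Ks nKs]] := ray_boundary cK z0 Kb.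
  by exists s; split; [exact: ls|exact: (SK _).2 (conj Ks nKs)].
have s2 : 2^-1 <= s by apply: le_trans ls; move: (l) lh => q qh; lra.
exists s; split; [exact: Ss| |exact: s2].
have := out _ Ss; rewrite dotBl dotZl -alE subr_le0 dotDl -alE => sal.
have tk : `|dot (t *: v) nu| <= t * c / al * al.
  by rewrite divfK ?gt_eqF// dotZl normrM gtr0_norm// ler_wpM2l// ltW.
have q0 : 0 <= t * c / al by rewrite -mulrA mulr_ge0// ltW.
have s1 : s - 1 <= 2 * (t * c / al).
  move: sal tk tv.
  move: (dot (t *: v) nu) (t * c / al) q0 ta => k q q0 ta sal.
  rewrite !ler_norml => /andP[k1 k2] /andP[k3 k4].
  by clear - sal k1 k2 k3 k4 q0 ta xnu; rewrite leNgt; apply/negP => sq; nra.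
have -> : (c / r + 2 * c / al) * t = l + 2 * (t * c / al) by rewrite lE; ring.
move: (t * c / al) q0 s1 => q q0 s1; clear - q0 s1 l0 ls.
by rewrite ler_norml; apply/andP; split; lra.
Qed.

End OutwardNormal.

(** * Uniqueness of the outward normal *)

Section Uniqueness.
Context {R : realType}.
Local Notation V := 'rV[R]_3.
Implicit Types (x y z v nu mu : V) (K Sigma : set V).

(** The secants from [x] to the points of [boundary_curve] would become
    orthogonal to both normals, hence to the combination [v] of them, along which
    these points move away from [x]. *)
Lemma ovoid_normal_unique K Sigma x nu mu : convex_set K -> compact K ->
  K° 0 -> (forall y, Sigma y <-> K y /\ ~ K° y) ->
  outward_normal Sigma x nu -> outward_normal Sigma x mu -> nu = mu.
Proof.
move=> convK cK K0 SK onu omu.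
have xnu := outward_normal_pos cK K0 SK onu.
have xmu := outward_normal_pos cK K0 SK omu.
have [tnu _] := onu; have [tmu _] := omu.
have nu1 : enorm nu = 1 by case: tnu. have mu1 : enorm mu = 1 by case: tmu.
(* A combination of nu and mu that is orthogonal to x. *)
pose v := dot x mu *: nu - dot x nu *: mu.
have xv : dot x v = 0 by rewrite dotBr !dotZr mulrC subrr.
have [v0|v0] := eqVneq v 0.
  have E : dot x mu *: nu = dot x nu *: mu by apply/eqP; rewrite -subr_eq0; exact/eqP.
  have := congr1 (@enorm R) E; rewrite !enormZ nu1 mu1 !mulr1 !gtr0_norm// => E2.
  move: E; rewrite E2 => /(congr1 (fun z => (dot x nu)^-1 *: z)).
  by rewrite !scalerA mulVf ?gt_eqF// !scale1r.
have vv : 0 < dot v v by rewrite dot_gt0.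
have [L [t0 [L0 t00 curve]]] := boundary_curve v convK cK K0 SK onu.
(* The boundary point y built below satisfies enorm (y - x) <= t * M, whereas
   dot (y - x) v >= t * dot v v / 2. *)
have [M ME] : exists M, M = L * enorm x + (1 + L) * enorm v by eexists.
have M0 : 0 < M.
  rewrite ME ltr_wpDl ?mulr_ge0 ?enorm_ge0// mulr_gt0 ?enorm_gt0//.
  by rewrite ltr_wpDr.
have [D DE] : exists D, D = dot x mu + dot x nu by eexists.
have D0 : 0 < D by rewrite DE addr_gt0.
have [e eE] : exists e, e = dot v v / (4 * D * M) by eexists.
have e0 : 0 < e by rewrite eE divr_gt0// !mulr_gt0.
have [d1 [d10 h1]] := tangent_plane_secant tnu e0.
have [d2 [d20 h2]] := tangent_plane_secant tmu e0.
have [d [d0 dd1 dd2]] : exists d, [/\ 0 < d, d <= d1 & d <= d2].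
  by exists (Num.min d1 d2); rewrite lt_min d10 d20 ge_min lexx ge_min lexx orbT.
have [t [tt0 tp tM t1]] : exists t, [/\ t <= t0, 0 < t, t * M < d & t <= 1].
  exists (Num.min (Num.min t0 1) (d / M / 2)).
  have dM : 0 < d / M / 2 by rewrite !divr_gt0.
  split; last 1 first.
  - by rewrite !ge_min lexx orbT.
  - by rewrite !ge_min lexx.
  - by rewrite !lt_min t00 ltr01 dM.
  - rewrite -ltr_pdivlMr// gt_min ltr_pdivrMr// mulr2n mulrDr mulr1 ltrDl.
    by rewrite divr_gt0 ?orbT.
have [|s [Ss s1 s2]] := curve t; first by rewrite tp.
have [y yE] : exists y, y = s *: (x + t *: v) by eexists.
rewrite -yE in Ss.
have yx : y - x = (s - 1) *: x + (s * t) *: v.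
  by rewrite yE scalerDr scalerA scalerBl scale1r addrAC.
have yxM : enorm (y - x) <= t * M.
  rewrite yx; apply: le_trans (ler_enormD _ _) _; rewrite !enormZ normrM (gtr0_norm tp).
  have sL : `|s| <= 1 + L.
    rewrite -[s](subrKC 1) (le_trans (ler_normD _ _))// normr1 lerD2l.
    by apply: le_trans s1 _; rewrite ler_piMr.
  have p1 : `|s - 1| * enorm x <= L * t * enorm x by rewrite ler_wpM2r ?enorm_ge0.
  have p2 : `|s| * t * enorm v <= (1 + L) * t * enorm v.
    by rewrite ler_wpM2r ?enorm_ge0// ler_wpM2r// ltW.
  apply: le_trans (lerD p1 p2) _; rewrite ME; move: (enorm x) (enorm v) => r w.
  by rewrite le_eqVlt; apply/orP; left; apply/eqP; ring.
have yd1 : enorm (y - x) < d1 by apply: le_lt_trans yxM _; apply: lt_le_trans dd1.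
have yd2 : enorm (y - x) < d2 by apply: le_lt_trans yxM _; apply: lt_le_trans dd2.
have k1 := h1 y Ss yd1; have k2 := h2 y Ss yd2.
have yv : dot (y - x) v = s * t * dot v v.
  by rewrite yx dotDl !dotZl xv mulr0 add0r.
have yv' : dot (y - x) v <= D * (e * (t * M)).
  have k : e * enorm (y - x) <= e * (t * M) by rewrite ler_wpM2l// ltW.
  rewrite DE /v dotBr !dotZr mulrDl lerD//.
    rewrite ler_wpM2l ?(ltW xmu)//; apply: le_trans k; apply: le_trans k1.
    exact: ler_norm.
  rewrite -mulrN ler_wpM2l ?(ltW xnu)//; apply: le_trans k; apply: le_trans k2.
  by rewrite -normrN ler_norm.
have De : D * (e * (t * M)) = t * dot v v / 4.
  by rewrite eE; field; rewrite !gt_eqF.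
move: yv'; rewrite De yv.
have tv : 0 < t * dot v v by rewrite mulr_gt0.
have p1 : 2^-1 * (t * dot v v) <= s * (t * dot v v) by rewrite ler_wpM2r// ltW.
rewrite -mulrA => p2; have := le_trans p1 p2.
by rewrite mulrC ler_pM2l// lef_pV2 ?posrE// ler_nat.
Qed.

Lemma outward_normal_unique Sigma x nu mu : ovoid Sigma ->
  outward_normal Sigma x nu -> outward_normal Sigma x mu -> nu = mu.
Proof.
move=> [K [[convK cK K0 SE] _]]; apply: (ovoid_normal_unique convK cK K0).
have clK : closed K by apply: compact_closed cK; exact: norm_hausdorff.
by move=> y; rewrite SE -(closure_id K).1.
Qed.

End Uniqueness.

(** * Orthonormal frames and spherical coordinates *)

Section OrthonormalFrames.
Context {R : realType}.
Local Notation V := 'rV[R]_3.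
Implicit Types (x y z v nu mu : V) (M : 'M[R]_3).

(** The three vectors [e i] form an orthonormal basis. *)
Definition orthonormal (e : 'I_3 -> V) : Prop :=
  forall i j, dot (e i) (e j) = (i == j)%:R.

Lemma orthonormal_mx e : orthonormal e ->
  (\matrix_i e i)^T *m (\matrix_i e i) = 1%:M.
Proof.
move=> oe; apply: mulmx1C; apply/matrixP => i j; rewrite !mxE -oe.
by apply: eq_bigr => k _; rewrite !mxE.
Qed.

Lemma trace_orthonormal e M : orthonormal e ->
  \sum_i dot (e i *m M) (e i) = \tr M.
Proof.
move=> oe; set O := \matrix_i e i.
transitivity (\tr (O *m M *m O^T)).
  apply: eq_bigr => i _; rewrite [RHS]mxE; apply: eq_bigr => k _.
  have -> : e i *m M = row i (O *m M) by rewrite row_mul rowK.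
  by rewrite [_ 0 k]mxE; congr (_ * _); rewrite !mxE.
by rewrite -mulmxA mxtrace_mulC -mulmxA orthonormal_mx// mulmx1.
Qed.

Lemma orthonormal_expand e y : orthonormal e -> y = \sum_i dot y (e i) *: e i.
Proof.
move=> oe; rewrite -[LHS]mulmx1 -(orthonormal_mx oe) mulmxA mulmx_sum_row.
apply: eq_bigr => i _; rewrite rowK; congr (_ *: _).
by rewrite mxE; apply: eq_bigr => k _; rewrite !mxE.
Qed.

(** The family with members [a], [b], [c]. *)
Definition triple (a b c : V) (i : 'I_3) : V :=
  if i == 0 then a else if i == 1 then b else c.

Lemma orthonormal_triple a b c : dot a a = 1 -> dot b b = 1 -> dot c c = 1 ->
  dot a b = 0 -> dot a c = 0 -> dot b c = 0 -> orthonormal (triple a b c).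
Proof.
move=> aa bb cc ab ac bc i j; rewrite /triple.
case: i j => [[|[|[|//]]] i3] [[|[|[|//]]] j3] //=; rewrite ?aa ?bb ?cc ?ab ?ac ?bc//;
  by rewrite dotC ?ab ?ac ?bc.
Qed.

(** Spectral theorem for a real symmetric matrix of order 2. *)
Lemma symmetric2_diag (a b d : R) : exists c s l m, [/\ c ^+ 2 + s ^+ 2 = 1,
  a * c + b * s = l * c, b * c + d * s = l * s,
  - (a * s) + b * c = - (m * s) & - (b * s) + d * c = m * c].
Proof.
have [->|b0] := eqVneq b 0.
  by exists 1, 0, a, d; split; ring.
have [r rE] : exists r, r = Num.sqrt ((a - d) ^+ 2 + 4 * b ^+ 2) by eexists.
have r2 : r ^+ 2 = (a - d) ^+ 2 + 4 * b ^+ 2.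
  by rewrite rE sqr_sqrtr// addr_ge0 ?sqr_ge0// mulr_ge0 ?sqr_ge0.
have [l lE] : exists l, l = (a + d + r) / 2 by eexists.
have lq : b ^+ 2 = (l - a) * (l - d).
  have -> : (l - a) * (l - d) = (r ^+ 2 - (a - d) ^+ 2) / 4 by rewrite lE; field.
  by rewrite r2; field.
have [n nE] : exists n, n = Num.sqrt (b ^+ 2 + (l - a) ^+ 2) by eexists.
have bb : 0 < b ^+ 2 by rewrite lt0r sqrf_eq0 b0 sqr_ge0.
have n2 : n ^+ 2 = b ^+ 2 + (l - a) ^+ 2.
  by rewrite nE sqr_sqrtr// addr_ge0 ?sqr_ge0.
have n0 : n != 0.
  by rewrite -sqrf_eq0 n2 gt_eqF// ltr_wpDr ?sqr_ge0.
exists (b / n), ((l - a) / n), l, (a + d - l); split.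
- by rewrite !expr_div_n -mulrDl -n2 divff// sqrf_eq0.
- by field.
- have -> : b * (b / n) + d * ((l - a) / n) = (b ^+ 2 + d * (l - a)) / n by field.
  by rewrite lq; field.
- have -> : - (a * ((l - a) / n)) + b * (b / n) = (b ^+ 2 - a * (l - a)) / n by field.
  by rewrite lq; field.
- by field.
Qed.

End OrthonormalFrames.

Section SphericalCoordinates.
Context {R : realType}.
Local Notation V := 'rV[R]_3.

Lemma sphere_normal_coord (t u : R) :
  [/\ sphere_normal t u 0 0 = cos t * sin u, sphere_normal t u 0 1 = sin t * sin u
    & sphere_normal t u 0 2%:R = cos u].
Proof. by rewrite !mxE. Qed.

Lemma sphere_normal_unit (t u : R) : unit_vector (sphere_normal t u).
Proof.
apply/unit_vectorP; rewrite dotE; have [-> -> ->] := sphere_normal_coord t u.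
have h1 := cos2Dsin2 t; have h2 := cos2Dsin2 u.
have -> : cos t * sin u * (cos t * sin u) + sin t * sin u * (sin t * sin u) +
  cos u * cos u = (cos t ^+ 2 + sin t ^+ 2) * sin u ^+ 2 + cos u ^+ 2 by ring.
by rewrite h1 mul1r addrC.
Qed.

Lemma rowV3P (x y : V) : x 0 0 = y 0 0 -> x 0 1 = y 0 1 -> x 0 2%:R = y 0 2%:R ->
  x = y.
Proof.
move=> h0 h1 h2; apply/rowP => -[[|[|[|//]]] i3].
- by move: h0; congr (x 0 _ = y 0 _); apply: val_inj.
- by move: h1; congr (x 0 _ = y 0 _); apply: val_inj.
- by move: h2; congr (x 0 _ = y 0 _); apply: val_inj.
Qed.

Lemma sphere_normal_antipode (t u : R) :
  sphere_normal (t + pi) (pi - u) = - sphere_normal t u.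
Proof.
have [h0 h1 h2] := sphere_normal_coord t u.
have [k0 k1 k2] := sphere_normal_coord (t + pi) (pi - u).
have s : sin (pi - u) = sin u by rewrite sinB sinpi cospi; ring.
have c : cos (pi - u) = - cos u by rewrite cosB sinpi cospi; ring.
apply: rowV3P; rewrite ?k0 ?k1 ?k2 ?[in RHS]mxE ?h0 ?h1 ?h2 ?s ?c //.
- by rewrite cosDpi mulNr.
- by rewrite sinDpi mulNr.
Qed.

Lemma polar_coordinates (a b : R) : exists t, 0 <= t < 2 * pi /\
  a = Num.sqrt (a ^+ 2 + b ^+ 2) * cos t /\ b = Num.sqrt (a ^+ 2 + b ^+ 2) * sin t.
Proof.
have pi0 := pi_gt0 R.
have [q qE] : exists q, q = Num.sqrt (a ^+ 2 + b ^+ 2) by eexists.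
rewrite -qE.
have ab0 : 0 <= a ^+ 2 + b ^+ 2 by rewrite addr_ge0 ?sqr_ge0.
have q2 : q ^+ 2 = a ^+ 2 + b ^+ 2 by rewrite qE sqr_sqrtr.
have qge0 : 0 <= q by rewrite qE sqrtr_ge0.
have [q0|qn0] := eqVneq q 0.
  exists 0; split; first by rewrite lexx mulr_gt0.
  have a2 := sqr_ge0 a; have b2 := sqr_ge0 b.
  have : a ^+ 2 + b ^+ 2 = 0 by rewrite -q2 q0 expr0n.
  move=> /eqP; rewrite paddr_eq0 ?sqr_ge0// !sqrf_eq0 => /andP[/eqP-> /eqP->].
  by rewrite q0 !mul0r.
have qp : 0 < q by rewrite lt0r qn0.
have aq : `|a| <= q.
  rewrite -(@ler_pXn2r _ 2) ?nnegrE// real_normK ?num_real// q2.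
  by rewrite lerDl sqr_ge0.
have aq1 : -1 <= a / q <= 1.
  by move: aq; rewrite ler_norml ler_pdivrMr// ler_pdivlMr// mul1r mulN1r.
have sE : sin (acos (a / q)) = `|b| / q.
  rewrite sin_acos//.
  have -> : 1 - (a / q) ^+ 2 = (b / q) ^+ 2.
    apply/eqP; rewrite subr_eq !expr_div_n -mulrDl addrC -q2 divff//.
    by rewrite sqrf_eq0.
  by rewrite sqrtr_sqr normrM normfV (gtr0_norm qp).
have cE : cos (acos (a / q)) = a / q by rewrite acosK// in_itv.
have a0 := acos_ge0 aq1; have api := acos_lepi aq1.
have [b0|b0] := leP 0 b.
  exists (acos (a / q)); split.
    by rewrite a0 /= (le_lt_trans api)// mulr2n mulrDl mul1r ltrDl.
  rewrite cE sE (ger0_norm b0); split; by rewrite mulrC divfK.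
have alt1 : -1 <= a / q < 1.
  move/andP: aq1 => [-> /= a1]; rewrite lt_neqAle a1 andbT.
  apply/eqP => aq1; have : q ^+ 2 = q ^+ 2 + b ^+ 2.
    by rewrite {1}q2 -[in RHS](mul1r q) -aq1 divfK.
  move/eqP; rewrite -subr_eq0 opprD addrA subrr sub0r oppr_eq0 sqrf_eq0.
  by rewrite lt_eqF.
have agt0 := acos_gt0 alt1.
exists (2 * pi - acos (a / q)); split.
  by rewrite subr_ge0 gtrDl oppr_lt0 agt0 andbT (le_trans api)// mulr2n mulrDl mul1r lerDl ltW.
have c2 : cos (2 * pi - acos (a / q)) = a / q.
  have -> : 2 * pi - acos (a / q) = - acos (a / q) + pi *+ 2 by rewrite mulr2n; ring.
  by rewrite cosD2pi cosN.
have s2 : sin (2 * pi - acos (a / q)) = - (`|b| / q).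
  have -> : 2 * pi - acos (a / q) = - acos (a / q) + pi *+ 2 by rewrite mulr2n; ring.
  by rewrite sinD2pi sinN sE.
rewrite c2 s2 (ltr0_norm b0); split; first by rewrite mulrC divfK.
by rewrite mulNr opprK mulrC divfK.
Qed.

Lemma sphere_normal_surj (n : V) : unit_vector n ->
  exists t u, param_domain t u /\ sphere_normal t u = n.
Proof.
move=> /unit_vectorP; rewrite dotE => n1.
have [t [tpi [ht0 ht1]]] := polar_coordinates (n 0 0) (n 0 1).
have n2 : n 0 0 ^+ 2 + n 0 1 ^+ 2 = 1 - n 0 2%:R ^+ 2 by rewrite -n1; ring.
have n20 : n 0 2%:R ^+ 2 <= 1 by rewrite -subr_ge0 -n2 addr_ge0 ?sqr_ge0.
have nb : -1 <= n 0 2%:R <= 1.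
  by rewrite -ler_norml -(@ler_pXn2r _ 2) ?nnegrE// real_normK ?num_real// expr1n.
exists t, (acos (n 0 2%:R)); split; first by split=> //; rewrite acos_ge0 ?acos_lepi.
have [h0 h1 h2] := sphere_normal_coord t (acos (n 0 2%:R)).
apply: rowV3P.
- by rewrite h0 sin_acos// -n2 mulrC -ht0.
- by rewrite h1 sin_acos// -n2 mulrC -ht1.
- by rewrite h2 acosK// in_itv.
Qed.

(** The frame consists of the unit vectors in the directions of the colatitude
    and of the longitude. *)
Lemma sphere_frame (n : V) : unit_vector n -> exists f0 f1,
  [/\ dot f0 f0 = 1, dot f1 f1 = 1, dot f0 f1 = 0, dot f0 n = 0 & dot f1 n = 0].
Proof.
move=> /sphere_normal_surj[t [u [_ <-]]].
pose f0 : V := \row_(i < 3) [:: cos t * cos u; sin t * cos u; - sin u]`_i.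
pose f1 : V := \row_(i < 3) [:: - sin t; cos t; 0]`_i.
have [h0 h1 h2] := sphere_normal_coord t u.
have [a0 a1 a2] : [/\ f0 0 0 = cos t * cos u, f0 0 1 = sin t * cos u &
  f0 0 2%:R = - sin u] by rewrite !mxE.
have [b0 b1 b2] : [/\ f1 0 0 = - sin t, f1 0 1 = cos t & f1 0 2%:R = 0] by rewrite !mxE.
have ht := cos2Dsin2 t; have hu := cos2Dsin2 u.
exists f0, f1; split; rewrite dotE ?a0 ?a1 ?a2 ?b0 ?b1 ?b2 ?h0 ?h1 ?h2.
- rewrite -hu -[X in _ = X + _]mul1r -ht; ring.
- rewrite -ht; ring.
- ring.
- transitivity ((cos t ^+ 2 + sin t ^+ 2) * (cos u * sin u) - cos u * sin u); first ring.
  by rewrite ht mul1r subrr.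
- ring.
Qed.

End SphericalCoordinates.

(** * Hessian matrix and radii of curvature *)

Section HessianMatrix.
Context {R : realType}.
Local Notation V := 'rV[R]_3.
Implicit Types (f : V -> R) (x y z u v n : V).

Lemma C2_smooth f : C1_off_origin f -> (forall v, C1_off_origin ('D_v f)) ->
  smooth 2 punctured f.
Proof.
move=> c1 c2; apply: smoothS => [x x0|v x x0|v].
- by apply: differentiable_continuous; case: (c1 x x0).
- by apply: diff_derivable; case: (c1 x x0).
apply: smoothS => [x x0|w x x0|w].
- by case: (c1 x x0) => _ /(_ v).
- by apply: diff_derivable; case: (c2 v x x0).
by split => // x x0; case: (c2 v x x0) => _ /(_ w).
Qed.

Lemma derive_coord f x v : differentiable f x ->
  'D_v f x = \sum_(i < 3) v 0 i * 'D_(delta_mx 0 i) f x.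
Proof.
move=> df; rewrite (deriveE v df) {1}(row_sum_delta v) linear_sum.
apply: eq_bigr => i _; rewrite linearZ.
by rewrite (deriveE (delta_mx 0 i) df).
Qed.

(** The matrix of the second derivatives of [f] at [x]. *)
Definition hessian_mx f x : 'M[R]_3 :=
  \matrix_(i, j) 'D_(delta_mx 0 i) ('D_(delta_mx 0 j) f) x.

Section C2Function.
Variable f : V -> R.
Hypothesis c1 : C1_off_origin f.
Hypothesis c2 : forall v, C1_off_origin ('D_v f).

Lemma derive2_hessian x u v : x != 0 ->
  'D_u ('D_v f) x = dot (u *m hessian_mx f x) v.
Proof.
move=> x0.
have dj j : differentiable ('D_(delta_mx 0 j) f) x by case: (c2 (delta_mx 0 j) x0).
have E : 'D_u ('D_v f) x =
    'D_u (\sum_(j < 3) (fun y => v 0 j *: ('D_(delta_mx 0 j) f y : R))) x.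
  apply: open_eq_derive open_punctured x0 _ => y y0.
  by rewrite fct_sumE derive_coord//; case: (c1 y0).
have h : is_derive x u (\sum_(j < 3) (fun y => v 0 j *: ('D_(delta_mx 0 j) f y : R)))
    (\sum_(j < 3) v 0 j *: 'D_u ('D_(delta_mx 0 j) f) x).
  apply: is_derive_sum => j; apply: is_deriveZ.
  exact/derivableP/diff_derivable.
apply: etrans E _; case: h => _ ->; rewrite /dot; apply: eq_bigr => j _.
rewrite [RHS]mulrC [_ *: _]/(_ * _); congr (_ * _).
rewrite [RHS]mxE (derive_coord u (dj j)).
by apply: eq_bigr => i _; rewrite mxE.
Qed.

Lemma lap_hessian x : lap f x = \tr (hessian_mx f x).
Proof. by apply: eq_bigr => i _; rewrite mxE. Qed.

End C2Function.

Lemma derive_ray f x (c : R) : (forall s : R, 0 < s -> f (s *: x) = c) ->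
  'D_x f x = 0.
Proof.
move=> fc; have x0 : x = 0 *: x + x by rewrite scale0r add0r.
have E : 'D_x f (0 *: x + x) = 'D_1 (fun h : R => f (h *: x + x)) 0.
  exact: derive_line.
transitivity ('D_x f (0 *: x + x)); first by rewrite -x0.
apply: etrans E _.
have E2 : 'D_1 (fun h : R => f (h *: x + x)) 0 = 'D_1 (cst c) (0 : R).
  apply: near_eq_derive; near=> h.
  rewrite -[X in _ + X]scale1r -scalerDl fc//.
  have h1 : -1 < h by near: h; apply: lt_nbhsr; rewrite ltrN10.
  by rewrite -ltrBlDr sub0r.
by apply: etrans E2 _; exact: derive_cst.
Unshelve. all: by end_near. Qed.

Lemma radial_extension_scale (p : V -> R) (s : R) x : 0 < s ->
  radial_extension p (s *: x) = radial_extension p x.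
Proof.
move=> s0; rewrite /radial_extension enormZ gtr0_norm// scalerA invfM.
by rewrite mulrAC mulVf ?mul1r// gt_eqF.
Qed.

Lemma radial_extension_unit (p : V -> R) n : unit_vector n ->
  radial_extension p n = p n.
Proof. by rewrite /radial_extension => ->; rewrite invr1 scale1r. Qed.

Section Radii.
Variable p : V -> R.
Hypothesis hC2 : C2_on_sphere p.
Local Notation F := (radial_extension p).
Local Notation Hm := (hessian_mx (radial_extension p)).

Let c1 : C1_off_origin F. Proof. by case: hC2. Qed.
Let c2 v : C1_off_origin ('D_v F). Proof. by case: hC2 => _; exact. Qed.
Let sF : smooth 2 punctured F. Proof. exact: C2_smooth. Qed.

Lemma derive_radial_ray x : x != 0 -> 'D_x F x = 0.
Proof.
by move=> x0; apply: (@derive_ray _ _ (F x)) => s s0; exact: radial_extension_scale.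
Qed.

(** Along a ray, the extension is constant. *)
Lemma hessian_ray x : x != 0 -> dot (x *m Hm x) x = 0.
Proof.
move=> x0; rewrite -(derive2_hessian c1 c2)//.
apply: (@derive_ray _ _ 0) => s s0.
have E : 'D_x F (s *: x) = 1 / s * 'D_x F x.
  apply: derive_homogeneous; rewrite ?gt_eqF//.
    by move=> y _; rewrite mul1r; exact: radial_extension_scale.
  by move=> y; exact: smooth_derivable sF.
by apply: etrans E _; rewrite derive_radial_ray// mulr0.
Qed.

Lemma derive_sphere_grad x v : x != 0 -> 'D_v (sphere_grad p) x = v *m Hm x.
Proof.
move=> x0; have ds : derivable (sphere_grad p) x v.
  apply/derivable_mxP => i j.
  have -> : (fun y => sphere_grad p y i j) = 'D_(delta_mx 0 j) F.
    by apply/funext => y; rewrite mxE.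
  by apply: diff_derivable; case: (c2 (delta_mx 0 j) x0).
rewrite (derive_mx ds); apply/rowP => j; rewrite [LHS]mxE.
have -> : (fun y => sphere_grad p y 0 j) = 'D_(delta_mx 0 j) F.
  by apply/funext => y; rewrite mxE.
apply: etrans (derive2_hessian c1 c2 v (delta_mx 0 j) x0) _.
by rewrite dotC dot_delta.
Qed.

Lemma sphere_hessianE n v : n != 0 ->
  sphere_hessian p n v = v *m Hm n - dot (v *m Hm n) n *: n.
Proof. by move=> n0; rewrite /sphere_hessian derive_sphere_grad. Qed.

(** The trace of the operator whose eigenvalues are the radii: the normal
    completes the eigenbasis to an orthonormal basis of space, and contributes 0
    to the Laplacian. *)
Lemma radii_sum n r0 r1 : unit_vector n -> radii_at_normal p n r0 r1 ->
  r0 + r1 = lap F n + 2 * p n.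
Proof.
move=> n1 [e0 [e1 [[e0n e1n u0 u1 e01] [E0 E1]]]].
have n0 := unit_vector_neq0 n1.
have uu0 := (unit_vectorP e0).1 u0; have uu1 := (unit_vectorP e1).1 u1.
have nn := (unit_vectorP n).1 n1.
have := congr1 (fun z => dot z e0) E0; have := congr1 (fun z => dot z e1) E1.
rewrite !sphere_hessianE// !dotDl !dotNl !dotZl uu0 uu1 (dotC n e0) (dotC n e1).
rewrite e0n e1n !mulr0 !subr0 !mulr1 => <- <-.
have oe := orthonormal_triple uu0 uu1 nn e01 e0n e1n.
rewrite lap_hessian -(trace_orthonormal _ oe) sum3 /triple /= hessian_ray//.
move: (dot _ _) (dot _ _) => q1 q2; ring.
Qed.

(** The operator preserves the tangent plane, where it is symmetric because the
    second derivatives are. *)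
Lemma radii_exist n : unit_vector n -> exists r0 r1, radii_at_normal p n r0 r1.
Proof.
move=> n1; have n0 := unit_vector_neq0 n1.
have nn := (unit_vectorP n).1 n1.
have [f0 [f1 [ff0 ff1 f01 f0n f1n]]] := sphere_frame n1.
have oe := orthonormal_triple ff0 ff1 nn f01 f0n f1n.
pose A v := sphere_hessian p n v + p n *: v.
have AE v : dot v n = 0 ->
    A v = (dot (v *m Hm n) f0 + p n * dot v f0) *: f0 +
          (dot (v *m Hm n) f1 + p n * dot v f1) *: f1.
  move=> vn; rewrite [LHS](orthonormal_expand _ oe) sum3 /triple /=.
  rewrite /A sphere_hessianE// !dotDl !dotNl !dotZl nn vn (dotC n f0) (dotC n f1).
  by rewrite f0n f1n !mulr0 mulr1 !subr0 subrr addr0 scale0r addr0.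
have sym : dot (f1 *m Hm n) f0 = dot (f0 *m Hm n) f1.
  have h1 := derive2_hessian c1 c2 f1 f0 n0.
  have h2 := derive2_hessian c1 c2 f0 f1 n0.
  exact: etrans (esym h1) (etrans (derive2C f1 f0 (@open_punctured R) n0 sF) h2).
pose a := dot (f0 *m Hm n) f0 + p n; pose d := dot (f1 *m Hm n) f1 + p n.
pose b := dot (f0 *m Hm n) f1.
have A0 : A f0 = a *: f0 + b *: f1.
  by rewrite (AE f0 f0n) ff0 f01 mulr0 mulr1 addr0.
have A1 : A f1 = b *: f0 + d *: f1.
  by rewrite (AE f1 f1n) ff1 (dotC f1 f0) f01 mulr0 mulr1 addr0 sym.
have Alin (k l : R) : A (k *: f0 + l *: f1) = k *: A f0 + l *: A f1.
  rewrite /A !sphere_hessianE// mulmxDl -!scalemxAl dotDl !dotZl.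
  move: (f0 *m _) (f1 *m _) => g0 g1.
  apply/rowP => i; rewrite !mxE; ring.
have [c [s [l [m [cs E1 E2 E3 E4]]]]] := symmetric2_diag a b d.
exists l, m, (c *: f0 + s *: f1), (- s *: f0 + c *: f1); split.
  split; try apply/unit_vectorP; rewrite !dotDl ?dotDr ?dotZl ?dotZr ?(dotC f1 f0);
    rewrite ?ff0 ?ff1 ?f01 ?f0n ?f1n.
  - ring.
  - ring.
  - by rewrite -[RHS]cs; ring.
  - by rewrite -[RHS]cs; ring.
  - ring.
have comb (q1 q2 q3 k k' : R) : k *: (q1 *: f0 + q2 *: f1) + k' *: (q2 *: f0 + q3 *: f1) =
    (q1 * k + q2 * k') *: f0 + (q2 * k + q3 * k') *: f1.
  by apply/rowP => i; rewrite !mxE; ring.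
have e0 : A (c *: f0 + s *: f1) = l *: (c *: f0 + s *: f1).
  by rewrite Alin A0 A1 comb E1 E2 scalerDr !scalerA.
have e1 : A (- s *: f0 + c *: f1) = m *: (- s *: f0 + c *: f1).
  by rewrite Alin A0 A1 comb !mulrN E3 E4 scalerDr !scalerA mulrN.
by split; [exact: e0|exact: e1].
Qed.

End Radii.
End HessianMatrix.

(** * Deviation from constant width *)

Section ConstantWidth.
Context {R : realType}.
Local Notation V := 'rV[R]_3.
Implicit Types (x y z u v n : V).

Lemma constant_widthP (p : V -> R) (w : R) :
  constant_width p w <-> forall n, unit_vector n -> p n + p (- n) = w.
Proof.
split=> [cw n n1|cw t u _].
  have [t [u [tu <-]]] := sphere_normal_surj n1.
  by rewrite -sphere_normal_antipode; exact: cw.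
by rewrite /width /param sphere_normal_antipode; apply: cw; exact: sphere_normal_unit.
Qed.

Lemma derive2_affine (f : V -> R) (c : R) b v x :
  'D_v ('D_v (fun y => f (c *: y + b))) x =
  'D_(c *: v) ('D_(c *: v) f) (c *: x + b).
Proof.
have E1 := derive_affine f c b v.
have E2 := congr1 (fun g : V -> R => g x) (derive_affine ('D_(c *: v) f) c b v).
transitivity ('D_v (fun y => 'D_(c *: v) f (c *: y + b)) x); last exact: E2.
by congr (derive _ x v).
Qed.

Lemma unit_vectorN n : unit_vector n -> unit_vector (- n).
Proof. by rewrite /unit_vector enormN. Qed.

Section WidthDefect.
Variables (p : V -> R) (w : R).
Hypothesis hC2 : C2_on_sphere p.
Local Notation F := (radial_extension p).

Let c1 : C1_off_origin F. Proof. by case: hC2. Qed.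
Let c2 v : C1_off_origin ('D_v F). Proof. by case: hC2 => _; exact. Qed.
Let sF : smooth 2 punctured F. Proof. exact: C2_smooth. Qed.

(** The radial extension of [n |-> p n + p (- n) - w].  The affine form of the
    second argument is the one in which composition is differentiated. *)
Definition width_defect x : R := F x + (F (-1 *: x + 0) + cst (- w) x).
Local Notation G := width_defect.

Lemma width_defectE x : G x = F x + F (- x) - w.
Proof. by rewrite /G scaleN1r addr0 addrA. Qed.

Lemma width_defect_unit n : unit_vector n -> G n = p n + p (- n) - w.
Proof.
move=> n1; rewrite width_defectE (radial_extension_unit p n1).
by rewrite (radial_extension_unit p (unit_vectorN n1)).
Qed.

Lemma width_defect_scale (s : R) x : 0 < s -> G (s *: x) = G x.
Proof. by move=> s0; rewrite !width_defectE -scalerN !radial_extension_scale. Qed.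

Let sFN : smooth 2 punctured (fun x => F (-1 *: x + 0)).
Proof.
apply: smooth_sub (smooth_affine (-1) 0 sF) => x /= x0.
by rewrite /punctured /= scaleN1r addr0 oppr_eq0.
Qed.

Lemma smooth_width_defect : smooth 2 punctured G.
Proof.
have o := @open_punctured R.
exact: (smoothD o sF (smoothD o sFN (smooth_cst 2 punctured (- w)))).
Qed.

Lemma lap_width_defect x : x != 0 -> lap G x = lap F x + lap F (- x).
Proof.
move=> x0; have o := @open_punctured R.
have sc : smooth 2 punctured (cst (- w) : V -> R) by exact: smooth_cst.
have E1 := lapD o x0 sF (smoothD o sFN sc); have E2 := lapD o x0 sFN sc.
have E3 : lap (cst (- w) : V -> R) x = 0.
  apply: big1 => i _.
  have -> : 'D_(delta_mx 0 i) (cst (- w) : V -> R) = cst 0.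
    by apply/funext => y; exact: derive_cst.
  exact: derive_cst.
have nx0 : - x != 0 by rewrite oppr_eq0.
have E4 : lap (fun x => F (-1 *: x + 0)) x = lap F (- x).
  apply: eq_bigr => i _; apply: etrans (derive2_affine F (-1) 0 _ x) _.
  rewrite !scaleN1r addr0.
  apply: etrans (derive2_hessian c1 c2 _ _ nx0) _.
  apply: etrans _ (esym (derive2_hessian c1 c2 _ _ nx0)).
  by rewrite mulNmx dotNl dotNr opprK.
exact: etrans E1 (congr2 +%R erefl (etrans E2 (etrans (congr2 +%R E4 E3) (addr0 _)))).
Qed.

Lemma derive_width_defect_ray x : x != 0 ->
  \sum_(i < 3) x 0 i * 'D_(delta_mx 0 i) G x = 0.
Proof.
move=> x0; have dG : differentiable G x.
  have h1 : differentiable F x by case: (c1 x0).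
  have h2 : differentiable F ((fun y => -1 *: y + 0) x).
    by rewrite scaleN1r addr0; have [] := c1 (_ : - x != 0); rewrite // oppr_eq0.
  have h3 : differentiable (fun y : V => -1 *: y + 0) x by exact: ex_diff.
  have h4 := differentiable_comp h3 h2.
  have h5 : differentiable (cst (- w) : V -> R) x by exact: differentiable_cst.
  exact: (differentiableD h1 (differentiableD h4 h5)).
rewrite -(derive_coord x dG).
by apply: (@derive_ray _ _ _ (G x)) => s s0; exact: width_defect_scale.
Qed.

Local Notation N := (@radial_power R 2^-1).

Lemma radial_power_half x : N x = enorm x.
Proof. by rewrite /radial_power powR12_sqrt ?dot_ge0. Qed.

(** The extension of [n |-> p n + p (- n) - w] homogeneous of degree 1. *)
Definition cone x : R := N x * G x.

Lemma smooth_cone : smooth 2 punctured cone.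
Proof.
exact: (smoothM (@open_punctured R) (smooth_radial_power 2 2^-1) smooth_width_defect).
Qed.

Lemma cone_scale (s : R) x : 0 < s -> cone (s *: x) = s * cone x.
Proof.
move=> s0; rewrite /cone !radial_power_half enormZ gtr0_norm// width_defect_scale//.
by rewrite mulrA.
Qed.

Lemma lap_cone_unit n : unit_vector n -> lap cone n = lap G n + 2 * G n.
Proof.
move=> n1; have n0 := unit_vector_neq0 n1; have o := @open_punctured R.
have sN : smooth 2 punctured N by exact: smooth_radial_power.
have nn := (unit_vectorP n).1 n1.
have r1 a : radial_power a n = 1 by rewrite /radial_power nn powR1.
have E i : 'D_(delta_mx 0 i) ('D_(delta_mx 0 i) cone) n =
   'D_(delta_mx 0 i) ('D_(delta_mx 0 i) G) n + 2 * (n 0 i * 'D_(delta_mx 0 i) G n) +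
   G n * 'D_(delta_mx 0 i) ('D_(delta_mx 0 i) N) n.
  apply: etrans (derive2M _ o n0 sN smooth_width_defect) _.
  have -> : 'D_(delta_mx 0 i) N n = n 0 i.
    have [_ ->] := is_derive_radial_power 2^-1 (delta_mx 0 i) n0.
    by rewrite r1 mulr1 dot_delta divff ?pnatr_eq0// mul1r.
  by rewrite r1 mul1r.
have S : lap cone n = \sum_(i < 3) ('D_(delta_mx 0 i) ('D_(delta_mx 0 i) G) n +
    2 * (n 0 i * 'D_(delta_mx 0 i) G n) +
    G n * 'D_(delta_mx 0 i) ('D_(delta_mx 0 i) N) n).
  exact: eq_bigr (fun i _ => E i).
have S2 : lap cone n = lap G n + 2 * (\sum_(i < 3) n 0 i * 'D_(delta_mx 0 i) G n) +
    G n * lap N n.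
  rewrite S /lap; clear; rewrite (mulr_sumr _ _ _ 2) (mulr_sumr _ _ _ (G n)).
  by rewrite -!big_split.
have lN : lap N n = 2.
  by apply: etrans (lap_radial_power 2^-1 n0) _; rewrite r1; field.
by rewrite S2 derive_width_defect_ray// mulr0 addr0 lN mulrC.
Qed.

Hypothesis harm : forall n, unit_vector n -> lap G n + 2 * G n = 0.

Lemma width_defect_eq0 n : unit_vector n -> G n = 0.
Proof.
move=> n1; have n0 := unit_vector_neq0 n1.
have : cone n = 0.
  apply: (even_harmonic_eq0 smooth_cone cone_scale) => // x.
  - move=> x0; have [m [m1 xm]] := unit_decomp x0.
    have e0 : 0 < enorm x by rewrite enorm_gt0.
    have m0 := unit_vector_neq0 m1.
    have E : lap cone (enorm x *: m) = (enorm x)^-1 * lap cone m.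
      rewrite /lap mulr_sumr; apply: eq_bigr => i _.
      exact: derive2_homogeneous smooth_cone cone_scale _ _ _ e0 m0.
    by rewrite xm E lap_cone_unit// harm// mulr0.
  - by rewrite /cone !radial_power_half enormN !width_defectE opprK (addrC (F (- x))).
by rewrite /cone radial_power_half n1 mul1r.
Qed.

End WidthDefect.
End ConstantWidth.

Theorem mainTheorem5 (R : realType) (Sigma : set 'rV[R]_3)
    (p : 'rV[R]_3 -> R) (w : R)
    (hSigma : ovoid Sigma) (hp : support_function Sigma p)
    (hC2 : C2_on_sphere p) (hF : fourier_convergent (param p))
    (hw : 0 < w) :
  constant_width p w <->
  (forall P Q : 'rV[R]_3, opposite Sigma P Q ->
     forall rhoP rhoQ : R,
       mean_radius Sigma p P rhoP -> mean_radius Sigma p Q rhoQ ->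
       rhoP + rhoQ = w).
Proof.
pose G := width_defect p w.
have lapG n : unit_vector n -> lap G n = lap (radial_extension p) n +
    lap (radial_extension p) (- n).
  by move=> n1; apply: lap_width_defect => //; exact: unit_vector_neq0.
split=> [/constant_widthP cw P Q [t [u [_]]]|hrho].
  rewrite sphere_normal_antipode; have := sphere_normal_unit t u.
  move: (sphere_normal t u) => n n1 nP nQ rhoP rhoQ.
  move=> [a0 [a1 [[n' nP' rP] ->]]] [b0 [b1 [[m' mQ' rQ] ->]]].
  rewrite -(outward_normal_unique hSigma nP nP') in rP.
  rewrite -(outward_normal_unique hSigma nQ mQ') in rQ.
  rewrite (radii_sum hC2 n1 rP) (radii_sum hC2 (unit_vectorN n1) rQ).
  have := lapG n n1; have -> : lap G n = 0.
    have G0 y : y != 0 -> G y = cst 0 y.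
      move=> y0; have [m [m1 ->]] := unit_decomp y0.
      by rewrite /G width_defect_scale ?enorm_gt0// width_defect_unit// cw// subrr.
    apply: big1 => i _; have o := @open_punctured R.
    have D0 y : y != 0 -> 'D_(delta_mx 0 i) G y = cst 0 y.
      by move=> y0; apply: etrans (open_eq_derive _ o y0 G0) _; exact: derive_cst.
    apply: etrans (open_eq_derive _ o (unit_vector_neq0 n1) D0) _.
    exact: derive_cst.
  have := cw n n1.
  move: (lap _ n) (lap _ (- n)) (p n) (p (- n)) => q1 q2 q3 q4 h1 h2.
  by clear - h1 h2; lra.
apply/constant_widthP => n n1.
have -> : p n + p (- n) = G n + w by rewrite /G width_defect_unit// subrK.
rewrite /G (width_defect_eq0 hC2) ?add0r// => m m1.
have m1' := unit_vectorN m1.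
rewrite -/G lapG// /G width_defect_unit//.
have [t [u [tu mE]]] := sphere_normal_surj m1.
have [P oP _] := hp m m1; have [Q oQ _] := hp (- m) m1'.
have [a0 [a1 rP]] := radii_exist hC2 m1.
have [b0 [b1 rQ]] := radii_exist hC2 m1'.
have : (a0 + a1) / 2 + (b0 + b1) / 2 = w.
  apply: (hrho P Q).
  - by exists t, u; rewrite sphere_normal_antipode mE.
  - by exists a0, a1; split=> //; exists m.
  - by exists b0, b1; split=> //; exists (- m).
rewrite (radii_sum hC2 m1 rP) (radii_sum hC2 m1' rQ).
move: (lap _ m) (lap _ (- m)) (p m) (p (- m)) => q1 q2 q3 q4 h1.
by clear - h1; lra.
Qed.
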